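(* Let $n\ge 1$. There is a constant $C>0$ such that for all $\mathbf{a}\in \ell^1_{\nu}(\mathbb{Z}^n)$ and all $\Theta,\Theta'\in \operatorname{Skew}_n(\mathbb{R})$, $$\bigl|\, \|\pi_{\Theta}(\mathbf{a})\|-\|\pi_{\Theta'}(\mathbf{a})\|\, \bigr|\leq C\, \|\mathbf{a}\|_{\ell^1_{\nu}}\, \|\Theta-\Theta'\|^{1/2}.$$
   Context: $\operatorname{Skew}_n(\mathbb{R})$ is the set of real skew-symmetric $n\times n$ matrices; for matrices, $\|\cdot\|$ is the operator norm. For $\Theta\in\operatorname{Skew}_n(\mathbb{R})$, the noncommutative $n$-torus $\mathcal{A}_\Theta$ is the universal unital $C^*$-algebra generated by unitaries $U_1(\Theta),\dots,U_n(\Theta)$ subject to $U_i(\Theta)U_j(\Theta)=e^{2\pi i\Theta_{ij}}U_j(\Theta)U_i(\Theta)$ for all $i,j$. For $k=(k_1,\dots,k_n)\in\mathbb{Z}^n$ put $U^k(\Theta)=U_1(\Theta)^{k_1}\cdots U_n(\Theta)^{k_n}$ and $|k|=\sum_i|k_i|$. The weight is $\nu(k)=1+|k|$, and $\ell^1_\nu(\mathbb{Z}^n)$ is the space of complex families $\mathbf{a}=\{a(k)\}_{k\in\mathbb{Z}^n}$ with $\|\mathbf{a}\|_{\ell^1_\nu}=\sum_k|a(k)|\nu(k)<\infty$. For $\mathbf{a}\in\ell^1_\nu(\mathbb{Z}^n)$ put $\pi_\Theta(\mathbf{a})=\sum_{k\in\mathbb{Z}^n}a(k)U^k(\Theta)\in\mathcal{A}_\Theta$;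 $\|\pi_\Theta(\mathbf{a})\|$ is its $C^*$-norm in $\mathcal{A}_\Theta$. *)

(* Defs.v *)
From HB Require Import structures.
From mathcomp Require Import all_boot all_order all_algebra finmap.
From mathcomp Require Export complex.
From mathcomp Require Export all_classical all_reals all_analysis.
From mathcomp Require Import showcase.summability.

Set Implicit Arguments.
Unset Strict Implicit.
Unset Printing Implicit Defensive.

Import Order.TTheory GRing.Theory Num.Theory.
Import numFieldNormedType.Exports.

Local Open Scope classical_set_scope.
Local Open Scope ring_scope.

(* Unital C*-algebras over [R[i]]. A record rather than a Hierarchy Builder
   structure, because the hierarchy has no join of rings and normed modules
   below [numDomainType]. The ring structure of the carrier is declared after
   the record, from [cstar_mul] and [cstar_one]. The norm [`|x|] of a normed
   module over [R[i]] takes values in [R[i]]. *)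
Record cstarAlgType (R : realType) := CStarAlg {
  cstar_module : completeNormedModType R[i] ;
  cstar_mul : cstar_module -> cstar_module -> cstar_module ;
  cstar_one : cstar_module ;
  cstar_star : cstar_module -> cstar_module ;
  cstar_mulA : associative cstar_mul ;
  cstar_mul1l : left_id cstar_one cstar_mul ;
  cstar_mul1r : right_id cstar_one cstar_mul ;
  cstar_mulDl : left_distributive cstar_mul +%R ;
  cstar_mulDr : right_distributive cstar_mul +%R ;
  cstar_one_neq0 : cstar_one != 0 ;
  cstar_scaleAl : forall (c : R[i]) x y,
    c *: cstar_mul x y = cstar_mul (c *: x) y ;
  cstar_scaleAr : forall (c : R[i]) x y,
    c *: cstar_mul x y = cstar_mul x (c *: y) ;
  cstar_starD : {morph cstar_star : x y / x + y} ;
  cstar_starZ : forall (c : R[i]) x,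
    cstar_star (c *: x) = conjc c *: cstar_star x ;
  cstar_starM : forall x y,
    cstar_star (cstar_mul x y) = cstar_mul (cstar_star y) (cstar_star x) ;
  cstar_starK : involutive cstar_star ;
  cstar_normM : forall x y, `|cstar_mul x y| <= `|x| * `|y| ;
  cstar_identity : forall x, `|cstar_mul (cstar_star x) x| = `|x| ^+ 2
}.

Definition cstar_sort (R : realType) (A : cstarAlgType R) : Type :=
  cstar_module A.
Coercion cstar_sort : cstarAlgType >-> Sortclass.

Section CStarInstances.
Variables (R : realType) (A : cstarAlgType R).

HB.instance Definition _ := CompleteNormedModule.on (cstar_sort A).
HB.instance Definition _ := GRing.Zmodule_isNzRing.Build (cstar_sort A)
  (@cstar_mulA R A) (@cstar_mul1l R A) (@cstar_mul1r R A)
  (@cstar_mulDl R A) (@cstar_mulDr R A) (@cstar_one_neq0 R A).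
HB.instance Definition _ :=
  GRing.Lmodule_isLalgebra.Build R[i] (cstar_sort A) (@cstar_scaleAl R A).
HB.instance Definition _ :=
  GRing.Lalgebra_isAlgebra.Build R[i] (cstar_sort A) (@cstar_scaleAr R A).

Definition star (x : A) : A := cstar_star x.

End CStarInstances.

(* [`|x|] is a nonnegative real element of [R[i]], so taking the real part only
   changes its type. *)
Definition cnorm (R : realType) (A : cstarAlgType R) (x : A) : R :=
  complex.Re `|x|.

Definition unitary (R : realType) (A : cstarAlgType R) (u : A) : Prop :=
  star u * u = 1 /\ u * star u = 1.

Definition is_star_hom (R : realType) (A B : cstarAlgType R) (f : A -> B) :
    Prop :=
  [/\ {morph f : x y / x + y},
      forall (c : R[i]) (x : A), f (c *: x) = c *: f x,
      {morph f : x y / x * y},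
      f 1 = 1
    & forall x : A, f (star x) = star (f x)].

Section NCTorus.
Variables (R : realType) (n : nat).
Implicit Types (Theta : 'M[R]_n) (A B : cstarAlgType R) (k : 'rV[int]_n).

Definition skew_mx Theta : Prop := Theta^T = - Theta.

Definition expi2pi (t : R) : R[i] :=
  Complex (cos (2 * pi * t)) (sin (2 * pi * t)).

Definition nctorus_rel Theta A (U : 'I_n -> A) : Prop :=
  (forall i, unitary (U i)) /\
  (forall i j, U i * U j = expi2pi (Theta i j) *: (U j * U i)).

(* [A] together with [U] is the universal unital C*-algebra generated by
   unitaries subject to [nctorus_rel Theta]; this determines [(A, U)] up to a
   unique isomorphism. That [A] is generated by [U] as a C*-algebra is contained
   in the uniqueness clause. *)
Definition is_nctorus Theta A (U : 'I_n -> A) : Prop :=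
  nctorus_rel Theta U /\
  forall (B : cstarAlgType R) (V : 'I_n -> B), nctorus_rel Theta V ->
    (exists2 f : A -> B, is_star_hom f & forall i, f (U i) = V i) /\
    (forall f g : A -> B, is_star_hom f -> is_star_hom g ->
       (forall i, f (U i) = V i) -> (forall i, g (U i) = V i) -> f =1 g).

(* Integer powers of a unitary [u], with [u^-1 = star u]. *)
Definition uexpz A (u : A) (m : int) : A :=
  match m with
  | Posz p => u ^+ p
  | Negz p => star u ^+ p.+1
  end.

(* The product is taken in increasing order of the index. *)
Definition monomial A (U : 'I_n -> A) k : A :=
  \prod_(i < n) uexpz (U i) (k 0 i).

Definition weight k : R := 1 + \sum_(i < n) (`|k 0 i|)%:~R.

Definition l1weight_norm (a : 'rV[int]_n -> R[i]) : \bar R :=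
  \esum_(k in [set: 'rV[int]_n]) (Normc.normc (a k) * weight k)%:E.

Definition in_l1weight (a : 'rV[int]_n -> R[i]) : Prop :=
  (l1weight_norm a < +oo)%E.

(* [summability.sum] is the unordered sum: the limit of the sums over finite
   subsets of ['rV[int]_n], directed by inclusion. *)
Definition pi_rep A (U : 'I_n -> A) (a : 'rV[int]_n -> R[i]) : A :=
  summability.sum (fun k => a k *: monomial U k).

(* Not [`|x|], which for matrices is the entrywise maximum norm. *)
Definition euclid_norm (x : 'cV[R]_n) : R := Num.sqrt (\sum_i x i 0 ^+ 2).

Definition opnorm Theta : R :=
  sup [set euclid_norm (Theta *m x) | x in [set x | euclid_norm x <= 1]].

End NCTorus.

(* Main.v *)
Require Import Defs.
From mathcomp Require Import all_boot all_order all_algebra.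
From mathcomp Require Import finmap lra ring zify.

Set Implicit Arguments.
Unset Strict Implicit.
Unset Printing Implicit Defensive.

(** The norms on the two sides are compared through the left regular
    representation on [l^2 Z^n], where the matrix [Theta] only enters through the
    phases of a twisted convolution kernel.

    The C*-norm is the regular norm. Gauge automorphisms, which exist by the
    universal property of [A] applied to [A] itself, are contractive
    ([hom_contractive]); averaging with them kills any nonzero frequency, so the
    zeroth Fourier coefficient is bounded by the norm ([zero_coef_le]). This gives
    a trace on the span of the monomials, and the trace turns finitely supported
    coefficient families into a pre-Hilbert space on which [A] acts. A power trick
    with the C*-identity shows that the action does not increase norms
    ([sqnorm2M]). In the other direction, for a finite sum [X] the [N]-th
    power of [star X * X] is supported in a box with polynomially many points, so
    its norm exceeds its [l^2] norm by at most a polynomial factor in [N], and taking [N]-th roots shows that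
    the action does not decrease norms either ([cnorm_le_opnorm2]). This uses that
    [Z^n] has polynomial growth in place of amenability, and no C*-algebra other
    than the given ones has to be built.

    Changing the phases. The exponent of the cocycle is
    [\sum Theta_pq k_p l_q] over the pairs [p] after [q]. Changing one entry by [d]
    multiplies the kernel entrywise by [e(d (i_p - j_p) j_q)]. After damping by a
    function [m (i - j)] with [|1 - m k| <= C |d|^(1/2) (1 + |k|)], this becomes a
    Gram matrix of unit vectors, hence a contractive Schur multiplier; the
    undamped remainder is small in [l^1]. So each entry costs
    [C |d|^(1/2)] times the weighted norm of [a] ([l2_bounded_twist_step]), and
    every entry of [Theta - Theta'] is at most its operator norm
    ([entry_le_opnorm]). The general case follows by density of finite sums
    ([pi_rep_approx]). *)

Import Order.TTheory GRing.Theory Num.Theory.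
Import numFieldNormedType.Exports.
Import Normc.
Local Open Scope classical_set_scope.
Local Open Scope complex_scope.
Local Open Scope ring_scope.

(** * C*-norms as real numbers *)
Section CNorm.
Variables (R : realType) (A : cstarAlgType R).
Implicit Types (x y : A) (c : R[i]).

Lemma norm_cnormE x : `|x| = (cnorm x)%:C.
Proof.
rewrite /cnorm RRe_real // ger0_real //.
Qed.

Lemma norm_normcE c : `|c| = (normc c)%:C.
Proof. by rewrite normc_def; case: c. Qed.

Lemma cnorm_ge0 x : 0 <= cnorm x.
Proof. by rewrite -ler0c -norm_cnormE. Qed.

Lemma cnormD x y : cnorm (x + y) <= cnorm x + cnorm y.
Proof. by rewrite -lecR rmorphD /= -!norm_cnormE ler_normD. Qed.

Lemma cnormN x : cnorm (- x) = cnorm x.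
Proof. by apply: complexI; rewrite -!norm_cnormE normrN. Qed.

Lemma cnormB x y : cnorm (x - y) = cnorm (y - x).
Proof. by rewrite -cnormN opprB. Qed.

Lemma cnorm0 : cnorm (0 : A) = 0.
Proof. by apply: complexI; rewrite -!norm_cnormE normr0. Qed.

Lemma cnorm_eq0 x : cnorm x = 0 -> x = 0.
Proof. by move=> h; apply/eqP; rewrite -normr_eq0 norm_cnormE h. Qed.

Lemma cnormZ c x : cnorm (c *: x) = normc c * cnorm x.
Proof. by apply: complexI; rewrite rmorphM /= -!norm_cnormE -norm_normcE normrZ. Qed.

Lemma cnormM x y : cnorm (x * y) <= cnorm x * cnorm y.
Proof. by rewrite -lecR rmorphM /= -!norm_cnormE; exact: cstar_normM. Qed.

Lemma cnormMstar x : cnorm (star x * x) = cnorm x ^+ 2.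
Proof. by apply: complexI; rewrite rmorphXn /= -!norm_cnormE; exact: cstar_identity. Qed.

Lemma cnorm_sum I (r : seq I) (P : pred I) (F : I -> A) :
  cnorm (\sum_(i <- r | P i) F i) <= \sum_(i <- r | P i) cnorm (F i).
Proof.
elim/big_rec2: _ => [|i s x _ h]; first by rewrite cnorm0.
by rewrite (le_trans (cnormD _ _)) // lerD2l.
Qed.

(** Stated at the type [A] itself, so that consecutive rewrites all see the same
    scaling structure. *)
Lemma scale_mull c x y : c *: x * y = c *: (x * y).
Proof. by rewrite scalerAl. Qed.
Lemma scale_mulr c x y : x * (c *: y) = c *: (x * y).
Proof. by rewrite scalerAr. Qed.
Lemma scale_scale c d x : c *: (d *: x) = (c * d) *: x.
Proof. by rewrite scalerA. Qed.

Lemma starD : {morph @star R A : x y / x + y}.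
Proof. exact: cstar_starD. Qed.
Lemma starM x y : star (x * y) = star y * star x.
Proof. exact: cstar_starM. Qed.
Lemma starK : involutive (@star R A).
Proof. exact: cstar_starK. Qed.
Lemma starZ c x : star (c *: x) = conjc c *: star x.
Proof. exact: cstar_starZ. Qed.
Lemma star0 : star (0 : A) = 0.
Proof. by apply: (addrI (star 0)); rewrite -starD !addr0. Qed.
Lemma star1 : star (1 : A) = 1.
Proof. by rewrite -[LHS]mulr1 -[X in _ * X]starK -starM mulr1 starK. Qed.
Lemma starN x : star (- x) = - star x.
Proof. by apply: (addrI (star x)); rewrite -starD !subrr star0. Qed.
Lemma star_sum I (r : seq I) (P : pred I) (F : I -> A) :
  star (\sum_(i <- r | P i) F i) = \sum_(i <- r | P i) star (F i).
Proof. exact: (big_morph _ starD star0). Qed.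
Lemma starX x m : star (x ^+ m) = star x ^+ m.
Proof. by elim: m => [|m ih]; rewrite ?expr0 ?star1 // exprS starM ih exprSr. Qed.

Lemma cnorm_star x : cnorm (star x) = cnorm x.
Proof.
have key (z : A) : cnorm z <= cnorm (star z).
  have [-> |z0] := eqVneq (cnorm z) 0; first by rewrite cnorm_ge0.
  have zp : 0 < cnorm z by rewrite lt_def z0 cnorm_ge0.
  by rewrite -(ler_pM2r zp) -expr2 -cnormMstar cnormM.
by apply/eqP; rewrite eq_le key andbT -{2}(starK x) key.
Qed.

Lemma cnorm1 : cnorm (1 : A) = 1.
Proof.
have := cnormMstar (1 : A); rewrite star1 mul1r expr2.
have n0 : cnorm (1 : A) != 0 by apply/eqP => /cnorm_eq0/eqP; rewrite oner_eq0.
by move/eqP; rewrite -{1}[cnorm 1]mulr1 (inj_eq (mulfI n0)) eq_sym => /eqP.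
Qed.

Lemma cnorm_unitary x : unitary x -> cnorm x = 1.
Proof.
case=> h _; apply/eqP; rewrite -(@eqrXn2 _ 2) ?cnorm_ge0 //.
by rewrite -cnormMstar h cnorm1 expr1n.
Qed.

(** The C*-identity squares exactly on self-adjoint elements; restricting to
    exponents [2 ^ j] lets this replace any use of the spectral radius. *)
Lemma cnorm_selfadj_exp2 x j : star x = x -> cnorm (x ^+ (2 ^ j)) = cnorm x ^+ (2 ^ j).
Proof.
move=> sx; elim: j => [|j ih]; first by rewrite !expr1.
by rewrite expnSr !exprM expr2 -{1}sx -starX cnormMstar ih.
Qed.

(** Completeness of a C*-algebra in terms of the real norm, for an arbitrary
    filter: it serves both iterations indexed by [nat] and unordered sums. *)
Lemma cauchy_limit (T : Type) (F : set_system T) (FF : ProperFilter F) (u : T -> A) :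
  (forall e : R, 0 < e -> exists2 S : set T, F S &
     forall s t, S s -> S t -> cnorm (u s - u t) < e) ->
  forall e : R, 0 < e -> \forall t \near F, cnorm (lim (u @ F) - u t) < e.
Proof.
move=> hu.
have cu : cvg (u @ F).
  apply/cauchy_cvgP/cauchy_exP => e e0.
  have e0' : 0 < complex.Re e by move: e0; rewrite ltcE => /andP[].
  have eE : e = (complex.Re e)%:C by rewrite RRe_real // ger0_real // ltW.
  have [S FS hS] := hu _ e0'.
  have [s Ss] := filter_ex FS; exists (u s).
  change (F (u @^-1` ball (u s) e)); apply: filterS FS => t St /=; rewrite -ball_normE /= eE norm_cnormE ltcR; exact: hS.
move=> e e0.
have /cvgrPdist_lt/(_ e%:C) := cu.
rewrite ltcR => /(_ e0); apply: filterS => t.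
by rewrite norm_cnormE ltcR.
Qed.

End CNorm.

(** * Square roots near the identity *)
Lemma normc_real (R : realType) (t : R) : normc (t%:C) = `|t|.
Proof. by rewrite /= expr0n /= addr0 sqrtr_sqr. Qed.

Lemma exp_small (R : realType) (r e : R) : 0 <= r < 1 -> 0 < e ->
  exists N, r ^+ N < e.
Proof.
move=> /andP[r0 r1] e0.
have := @cvg_expr R r; rewrite ger0_norm // => /(_ r1) /cvgrPdist_lt /(_ e e0).
case=> N _ /(_ N (leqnn _)) /=; rewrite sub0r normrN ger0_norm ?exprn_ge0 // => h.
by exists N.
Qed.

Section Sqrt.
Variables (R : realType) (A : cstarAlgType R).
Implicit Types (x y w : A).

Lemma small_eq0 x (M : R) : (forall e, 0 < e -> cnorm x <= M * e) -> x = 0.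
Proof.
move=> h; apply: cnorm_eq0; apply/eqP; rewrite eq_le cnorm_ge0 andbT.
apply/ler_addgt0Pr => e e0; rewrite add0r.
have M1 : 0 < `|M| + 1 by rewrite ltr_wpDl.
apply: (le_trans (h (e / (`|M| + 1)) _)); first by rewrite divr_gt0.
rewrite mulrA ler_pdivrMr // mulrC ler_wpM2l ?(ltW e0) //.
by rewrite (le_trans (ler_norm M)) // lerDl.
Qed.

(** With [b = 1 - l] the equation [b * b = 1 - h] reads [l = (h + l * l) / 2].
    The right-hand side is a contraction of ratio [r = (1 + cnorm h) / 2] on the
    ball of radius [r], so its iterates from [0] converge; they are self-adjoint
    and commute with whatever commutes with [h], and the limit inherits both. *)
Lemma sqrt_one_sub (h : A) : star h = h -> cnorm h < 1 ->
  exists b : A, [/\ star b = b, b * b = 1 - h &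
    forall w, w * h = h * w -> w * b = b * w].
Proof.
move=> sh h1.
pose f y : A := (2^-1)%:C *: (h + y * y).
pose y n := iter n f 0.
pose r : R := (1 + cnorm h) / 2.
have h0 := cnorm_ge0 h.
have r0 : 0 <= r by rewrite /r; lra.
have r1 : r < 1 by rewrite /r; lra.
have n2 : normc ((2^-1)%:C : R[i]) = 2^-1 by rewrite normc_real ger0_norm // invr_ge0.
have yr n : cnorm (y n) <= r.
  elim: n => [|n ih]; first by rewrite cnorm0.
  rewrite /= cnormZ n2 ler_pdivrMl //.
  apply: (le_trans (cnormD _ _)).
  have := cnormM (y n) (y n); have := cnorm_ge0 (y n); rewrite -/(y n).
  move: (cnorm (y n)) ih => t tr t0 tt; have : t * t <= r * r by rewrite ler_pM.
  rewrite /r; nra.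
have sy n : star (y n) = y n.
  elim: n => [|n ih]; first exact: star0.
  by rewrite /= starZ starD starM -/(y n) ih sh conjc_real.
have wy w n : w * h = h * w -> w * y n = y n * w.
  move=> wh; elim: n => [|n ih]; first by rewrite mulr0 mul0r.
  by rewrite /= -/(y n) -scalerAl -scalerAr mulrDl mulrDr wh mulrA ih -mulrA ih mulrA.
have sqB (s t : A) : s * s - t * t = s * (s - t) + (s - t) * t.
  by rewrite mulrBr mulrBl addrA subrK.
(* Contractivity propagates the crude bound [2] between any two iterates. *)
have ctr n m m' : cnorm (y (n + m)%N - y (n + m')%N) <= 2 * r ^+ n.
  elim: n => [|n ih].
    rewrite !add0n expr0 mulr1 (le_trans (cnormD _ _)) // cnormN.
    have := yr m; have := yr m'; lra.
  rewrite !addSn /= -scalerBr cnormZ n2 ler_pdivrMl // -/(y _) -/(y _).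
  rewrite opprD addrACA subrr add0r sqB.
  apply: (le_trans (cnormD _ _)).
  have := cnormM (y (n + m)%N) (y (n + m)%N - y (n + m')%N).
  have := cnormM (y (n + m)%N - y (n + m')%N) (y (n + m')%N).
  have := yr (n + m)%N; have := yr (n + m')%N.
  have := cnorm_ge0 (y (n + m)%N - y (n + m')%N).
  move: (cnorm (y (n+m)%N - _)) ih => d; rewrite exprS; nra.
pose l : A := lim (y @ \oo).
have lP e : 0 < e -> exists N, forall n, (N <= n)%N -> cnorm (l - y n) <= e.
  move=> e0; have [|N _ hN] := @cauchy_limit R A _ \oo _ y _ e e0.
    move=> d d0; have d2 : 0 < d / 2 by rewrite divr_gt0.
    have r01 : 0 <= r < 1 by rewrite r0.
    have [N hN] := exp_small r01 d2.
    exists [set n | (N <= n)%N]; first by exists N.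
    move=> s t /= Ns Nt; have := ctr N (s - N)%N (t - N)%N.
    rewrite !subnKC // => h'; apply: (le_lt_trans h'); lra.
  by exists N => n /hN /ltW.
exists (1 - l); split.
- rewrite starD starN star1; congr (1 - _).
  apply/subr0_eq/(@small_eq0 _ 2) => e e0; have [N /(_ N (leqnn _)) hN] := lP e e0.
  have -> : star l - l = star (l - y N) - (l - y N).
    by rewrite starD starN sy opprB addrA subrK.
  apply: (le_trans (cnormD _ _)); rewrite cnormN cnorm_star; lra.
- suff E : 2%:C *: l = h + l * l.
    have -> : h = l + (l - l * l).
      have -> : l + (l - l * l) = 2%:C *: l - l * l.
        by rewrite addrA -[in RHS](natr1 1) rmorphD scalerDl scale1r.
      by rewrite E addrK.
    by rewrite mulrBl mul1r mulrBr mulr1 [in RHS]opprD addrA.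
  apply/subr0_eq/(@small_eq0 _ (2 + cnorm l + r)) => e e0.
  have [N hN] := lP e e0.
  have -> : 2%:C *: l - (h + l * l) = 2%:C *: (l - y N.+1) - (l * (l - y N) + (l - y N) * y N).
    have -> : 2%:C *: (l - y N.+1) = 2%:C *: l - (h + y N * y N).
      rewrite scalerBr; congr (_ - _); rewrite /= -/(y N) scalerA -rmorphM /=.
      by rewrite mulfV ?scale1r // pnatr_eq0.
    by rewrite -sqB opprB !opprD !addrA subrK.
  apply: (le_trans (cnormD _ _)); rewrite cnormN cnormZ normc_real ger0_norm //.
  have := cnormD (l * (l - y N)) ((l - y N) * y N).
  have := cnormM l (l - y N); have := cnormM (l - y N) (y N).
  have := hN _ (leqnn _); have := hN _ (leqnSn _); have := yr N.
  have := cnorm_ge0 l; have := cnorm_ge0 (y N); have := cnorm_ge0 (l - y N).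
  nra.
- move=> w wh; apply/subr0_eq/(@small_eq0 _ (2 * cnorm w)) => e e0.
  have [N /(_ N (leqnn _)) hN] := lP e e0.
  have -> : w * (1 - l) - (1 - l) * w = (l - y N) * w - w * (l - y N).
    rewrite mulrBr mulr1 !mulrBl mul1r mulrBr (wy w N wh) !opprB addrC.
    by rewrite !addrA !subrK.
  apply: (le_trans (cnormD _ _)); rewrite cnormN.
  have := cnormM w (l - y N); have := cnormM (l - y N) w.
  have := cnorm_ge0 w; have := cnorm_ge0 (l - y N); nra.
Qed.
End Sqrt.

(** * Star homomorphisms are contractive *)
Section Hom.
Variables (R : realType) (A B : cstarAlgType R) (f : A -> B).
Hypothesis hf : is_star_hom f.

(** If [b * b = 1 - h * h] with [b] commuting with [h], then
    [f h + 'i f b] is unitary in the target and [f h] is its real part, hence has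
    norm at most [1]. No continuity of [f] is assumed. *)
Lemma hom_selfadj_le1 (h : A) : star h = h -> cnorm h < 1 -> cnorm (f h) <= 1.
Proof.
case: hf => fD fZ fM f1 fs sh h1.
have shh : star (h * h) = h * h by rewrite starM sh.
have hh1 : cnorm (h * h) < 1.
  by rewrite -{1}sh cnormMstar expr_lt1 ?cnorm_ge0.
have [b [sb bb bw]] := sqrt_one_sub shh hh1.
have fN x : f (- x) = - f x by rewrite -scaleN1r fZ scaleN1r.
pose y := f h; pose c := f b.
have yc : y * c = c * y by rewrite -!fM bw // mulrA.
have sy : star y = y by rewrite -fs sh.
have sc : star c = c by rewrite -fs sb.
have cc : c * c = 1 - y * y by rewrite -fM bb fD fN f1 fM.
pose u := y + 'i%C *: c.
have su : star u = y - 'i%C *: c.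
  rewrite starD starZ sy sc; congr (_ + _).
  by rewrite -scaleNr; congr (_ *: _); apply/eqP; rewrite eq_complex /= oppr0 !eqxx.
have u1 : cnorm u = 1.
  apply/eqP; rewrite -(@eqrXn2 _ 2) ?cnorm_ge0 // expr1n -cnormMstar su.
  rewrite /u mulrDr !mulrBl !(scale_mull, scale_mulr) yc scale_scale.
  have -> : 'i%C * 'i%C = -1 :> R[i] by rewrite -expr2 sqr_i.
  by rewrite scaleN1r cc opprK addrA subrK addrC subrK cnorm1.
have -> : f h = (2^-1)%:C *: (u + star u).
  rewrite su /u addrACA subrr addr0 scalerDr -scalerDl -rmorphD /=.
  have -> : 2^-1 + 2^-1 = 1 :> R by lra.
  exact: esym (scale1r _).
rewrite cnormZ normc_real ger0_norm ?invr_ge0 // ler_pdivrMl // mulr1.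
by rewrite (le_trans (cnormD _ _)) // cnorm_star u1.
Qed.

Lemma hom_contractive (x : A) : cnorm (f x) <= cnorm x.
Proof.
have [fD fZ fM f1 fs] := hf.
apply/ler_addgt0Pr => e e0.
set t := cnorm x + e.
have t0 : 0 < t by rewrite ltr_wpDl // cnorm_ge0.
pose h := (t ^- 2)%:C *: (star x * x).
have sh : star h = h by rewrite starZ starM starK conjc_real.
have tt : 0 < t ^- 2 by rewrite invr_gt0 exprn_gt0.
have h1 : cnorm h < 1.
  rewrite cnormZ normc_real gtr0_norm // cnormMstar mulrC ltr_pdivrMr ?exprn_gt0 //.
  by rewrite mul1r ltrXn2r ?cnorm_ge0 ?(ltW t0) // /t ltrDl.
have := hom_selfadj_le1 sh h1.
rewrite fZ fM fs cnormZ normc_real gtr0_norm // cnormMstar mulrC.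
by rewrite ler_pdivrMr ?exprn_gt0 // mul1r ler_pXn2r ?nnegrE ?cnorm_ge0 ?(ltW t0).
Qed.
End Hom.

(** * Monomials and their commutation phases *)
Section Phase.
Variable R : realType.
Implicit Types s t : R.
Local Notation e := (@expi2pi R).

Lemma expi2pi0 : e 0 = 1.
Proof. by rewrite /expi2pi mulr0 cos0 sin0. Qed.

Lemma expi2piD s t : e (s + t) = e s * e t.
Proof. by apply/eqP; rewrite /expi2pi mulrDr cosD sinD eq_complex /= eqxx /= addrC. Qed.

Lemma expi2piN t : e (- t) = conjc (e t).
Proof. by rewrite /expi2pi mulrN cosN sinN. Qed.

Lemma normc_expi2pi t : normc (e t) = 1.
Proof. by rewrite /= cos2Dsin2 sqrtr1. Qed.

Lemma expi2pi_half : e (2^-1) = -1.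
Proof.
rewrite /expi2pi mulrAC mulfV ?pnatr_eq0 // mul1r cospi sinpi.
by apply/eqP; rewrite eq_complex /= oppr0 !eqxx.
Qed.

Lemma normc_sub_expi2pi t : normc (1 - e t) <= 2 * trigo.pi * `|t|.
Proof.
set x := trigo.pi * t.
have -> : 2 * trigo.pi * `|t| = 2 * `|x|.
  by rewrite /x normrM (ger0_norm (pi_ge0 R)) mulrA.
have -> : normc (1 - e t) = 2 * `|sin x|.
  rewrite /expi2pi /= add0r -mulrA -/x mulr_natl mulr2n cosD sinD sqrrN.
  rewrite -[2]ger0_norm // -normrM -sqrtr_sqr; congr Num.sqrt.
  have := cos2Dsin2 x; set c := cos x; set s := sin x => h.
  have -> : 1 - (c * c - s * s) = 2 * s ^+ 2 by rewrite -[X in X - _]h; ring.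
  have -> : (s * c + c * s) ^+ 2 = 4 * s ^+ 2 * c ^+ 2 by ring.
  have -> : c ^+ 2 = 1 - s ^+ 2 by rewrite -[X in X - _]h addrK.
  ring.
rewrite ler_wpM2l //.
wlog x0 : x / 0 <= x.
  move=> H; have [/H//|/ltW x0] := leP 0 x.
  by rewrite -normrN -sinN -[in leRHS]normrN H // oppr_ge0.
have [|c _] := @MVT_segment R sin cos 0 x x0 (fun y _ => is_derive_sin y).
  by apply: continuous_subspaceT => y; exact: continuous_sin.
by rewrite sin0 !subr0 => ->; rewrite normrM ler_piMl // cos_max.
Qed.

End Phase.

Section Monomials.
Variables (R : realType) (A : cstarAlgType R).
Local Notation e := (@expi2pi R).
Implicit Types (u w : A).

Lemma uexpzS u (m : int) : unitary u -> uexpz u (m + 1) = u * uexpz u m.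
Proof.
case=> su us; case: m => [m|[|m]] /=.
- by rewrite addn1 exprS.
- by rewrite expr1 us.
- by rewrite [in RHS]exprS mulrA us mul1r subn1.
Qed.

Lemma uexpz_unitary u m : unitary u -> unitary (uexpz u m).
Proof.
move=> hu; have [su us] := hu.
have X w p : unitary w -> unitary (w ^+ p).
  case=> sw ws; elim: p => [|p [ih1 ih2]]; first by rewrite /unitary star1 mulr1.
  split; rewrite !exprS starM.
    by rewrite -mulrA (mulrA _ w) sw mul1r.
  by rewrite -mulrA (mulrA (w ^+ p)) ih2 mul1r.
case: m => p; rewrite /uexpz; apply: X => //.
by split; rewrite starK.
Qed.

Lemma uexpzD u m p : unitary u -> uexpz u (m + p) = uexpz u m * uexpz u p.
Proof.
move=> hu; elim/int_ind: m => [|m ih|m ih]; first by rewrite add0r mul1r.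
- by rewrite -addn1 PoszD addrAC uexpzS // ih uexpzS // mulrA.
- have P q : uexpz u q = star u * uexpz u (q + 1).
    by rewrite uexpzS // mulrA hu.1 mul1r.
  have mE : - m.+1%:Z + 1 = - m%:Z by rewrite -addn1 PoszD opprD subrK.
  by rewrite P addrAC mE ih [uexpz u (- m.+1%:Z)]P mE mulrA.
Qed.

Lemma comm_uexpz u w t m : unitary u -> w * u = e t *: (u * w) ->
  w * uexpz u m = e (t * m%:~R) *: (uexpz u m * w).
Proof.
move=> hu h; have [su us] := hu.
have h' : w * star u = e (- t) *: (star u * w).
  have : star u * (w * u) * star u = star u * (e t *: (u * w)) * star u by rewrite h.
  rewrite mulrA -mulrA us mulr1 scale_mulr scale_mull !mulrA su mul1r => ->.
  by rewrite scale_scale -expi2piD addNr expi2pi0 scale1r.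
have X v s p : w * v = e s *: (v * w) -> w * v ^+ p = e (s *+ p) *: (v ^+ p * w).
  move=> hv; elim: p => [|p ih]; first by rewrite mulr0n expi2pi0 scale1r !expr0 mulr1 mul1r.
  by rewrite !exprS mulrA hv scale_mull -mulrA ih scale_mulr scale_scale -expi2piD -mulrS mulrA.
case: m => p; rewrite /uexpz.
  by rewrite (X _ _ _ h) -[_%:~R]/(p%:R) mulr_natr.
by rewrite (X _ _ _ h') NegzE mulrNz -[_%:~R]/(p.+1%:R) mulrN mulr_natr mulNrn.
Qed.

Variables (n : nat) (Theta : 'M[R]_n) (U : 'I_n -> A).
Hypothesis hrel : nctorus_rel Theta U.

Lemma comm_uexpz2 i j m p :
  uexpz (U j) m * uexpz (U i) p =
  e (Theta j i * m%:~R * p%:~R) *: (uexpz (U i) p * uexpz (U j) m).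
Proof.
have [hu hc] := hrel.
have h1 := comm_uexpz p (hu i) (hc j i).
have h2 : uexpz (U i) p * U j = e (- (Theta j i * p%:~R)) *: (U j * uexpz (U i) p).
  by rewrite h1 scale_scale -expi2piD addNr expi2pi0 scale1r.
rewrite (comm_uexpz m (hu j) h2) scale_scale -expi2piD.
by rewrite mulNr mulrAC subrr expi2pi0 scale1r.
Qed.

End Monomials.

Section Form.
Variables (R : realType) (n : nat).
Local Notation e := (@expi2pi R).
Implicit Types (k l : 'rV[int]_n) (r : seq 'I_n) (M : 'M[R]_n).

(** The pairs [(j, i)] with [j] after [i] in [r]: moving [U i] to the left past
    the rest of an ordered monomial produces exactly the phases of these pairs. *)
Fixpoint later_pairs r : seq ('I_n * 'I_n) :=
  if r is i :: r' then [seq (j, i) | j <- r'] ++ later_pairs r' else [::].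

(** When [ps] lists all later pairs, this is the exponent of the 2-cocycle of [Z^n]
    attached to the ordered monomials. Keeping [ps] arbitrary allows the matrix to
    be changed one entry at a time. *)
Definition twist M (ps : seq ('I_n * 'I_n)) k l : R :=
  \sum_(pq <- ps) M pq.1 pq.2 * (k 0 pq.1)%:~R * (l 0 pq.2)%:~R.

Lemma twistDl M ps k k' l : twist M ps (k + k') l = twist M ps k l + twist M ps k' l.
Proof.
by rewrite /twist -big_split; apply: eq_bigr => pq _; rewrite mxE intrD mulrDr mulrDl.
Qed.

Variables (A : cstarAlgType R) (Theta : 'M[R]_n) (U : 'I_n -> A).
Hypothesis hrel : nctorus_rel Theta U.

Definition sub_monomial r k : A := \prod_(i <- r) uexpz (U i) (k 0 i).

Lemma sub_monomial_comm r k i p :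
  sub_monomial r k * uexpz (U i) p =
  e (\sum_(j <- r) Theta j i * (k 0 j)%:~R * p%:~R) *: (uexpz (U i) p * sub_monomial r k).
Proof.
rewrite /sub_monomial; elim: r => [|j r ih].
  by rewrite !big_nil expi2pi0 scale1r mul1r mulr1.
rewrite !big_cons -mulrA ih scale_mulr mulrA (comm_uexpz2 hrel) scale_mull scale_scale -expi2piD mulrA.
by rewrite addrC.
Qed.

Lemma sub_monomialM r k l :
  sub_monomial r k * sub_monomial r l =
  e (twist Theta (later_pairs r) k l) *: sub_monomial r (k + l).
Proof.
have hu := hrel.1; rewrite /twist; elim: r => [|i r ih] /=.
  by rewrite /sub_monomial !big_nil expi2pi0 scale1r mul1r.
rewrite big_cat big_map /=.
have cons s : sub_monomial (i :: r) s = uexpz (U i) (s 0 i) * sub_monomial r s.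
  by rewrite /sub_monomial big_cons.
rewrite !cons -mulrA (mulrA (sub_monomial r k)) sub_monomial_comm scale_mull scale_mulr.
rewrite -mulrA ih !scale_mulr scale_scale -expi2piD mulrA -uexpzD //.
by rewrite mxE.
Qed.

End Form.

(** * Gauge automorphisms and the zeroth Fourier coefficient *)
Section Torus.
Variables (R : realType) (n : nat).
Local Notation e := (@expi2pi R).
Implicit Types (k l : 'rV[int]_n).

Lemma twist0l (M : 'M[R]_n) ps l : twist M ps 0 l = 0.
Proof. by rewrite /twist big1 // => pq _; rewrite mxE mulr0 mul0r. Qed.

Lemma twistNl (M : 'M[R]_n) ps k l : twist M ps (- k) l = - twist M ps k l.
Proof. by apply/eqP; rewrite -addr_eq0 -twistDl addNr twist0l. Qed.

Lemma unitaryM (A : cstarAlgType R) (u v : A) : unitary u -> unitary v -> unitary (u * v).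
Proof.
move=> [su us] [sv vs]; split; rewrite starM -!mulrA.
  by rewrite (mulrA (star u)) su mul1r.
by rewrite (mulrA v) vs mul1r.
Qed.

Lemma uexpz_phase (A : cstarAlgType R) (u : A) t m :
  uexpz (e t *: u) m = e (t * m%:~R) *: uexpz u m.
Proof.
have X v s p : (e s *: v) ^+ p = e (s *+ p) *: v ^+ p :> A.
  elim: p => [|p ih]; first by rewrite mulr0n expi2pi0 scale1r !expr0.
  by rewrite !exprS ih scale_mull scale_mulr scale_scale -expi2piD -mulrS.
case: m => p; rewrite /uexpz; first by rewrite X -[_%:~R]/(p%:R) mulr_natr.
by rewrite starZ -expi2piN X NegzE mulrNz -[_%:~R]/(p.+1%:R) mulrN mulr_natr mulNrn.
Qed.

Lemma hom_uexpz (A B : cstarAlgType R) (f : A -> B) u m :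
  is_star_hom f -> f (uexpz u m) = uexpz (f u) m.
Proof.
case=> _ _ fM f1 fs.
have X v p : f (v ^+ p) = f v ^+ p.
  by elim: p => [|p ih]; rewrite ?expr0 // !exprS fM ih.
by case: m => p; rewrite /uexpz X ?fs.
Qed.

Variables (Theta : 'M[R]_n) (A : cstarAlgType R) (U : 'I_n -> A).
Hypothesis hT : is_nctorus Theta U.
Let hrel : nctorus_rel Theta U := hT.1.
Definition all_pairs : seq ('I_n * 'I_n) := later_pairs (index_enum 'I_n).
Local Notation W := (monomial U).
Local Notation phi := (twist Theta all_pairs).

Lemma monomialM k l : W k * W l = e (phi k l) *: W (k + l).
Proof. exact: (sub_monomialM hrel). Qed.

Lemma monomial0 : W 0 = 1.
Proof. by rewrite /monomial big1 // => i _; rewrite mxE. Qed.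

Lemma monomial_unitary k : unitary (W k).
Proof.
rewrite /monomial; elim/big_ind: _ => [|u v|i _].
- by split; rewrite star1 mulr1.
- exact: unitaryM.
- by apply: uexpz_unitary; exact: hrel.1.
Qed.

Lemma cnorm_monomial k : cnorm (W k) = 1.
Proof. exact/cnorm_unitary/monomial_unitary. Qed.

Lemma star_monomial k : star (W k) = e (phi k k) *: W (- k).
Proof.
have [_ h] := monomial_unitary k.
rewrite -[RHS]mulr1 -h scale_mull mulrA monomialM addNr monomial0 twistNl.
by rewrite scale_mull scale_scale -expi2piD subrr expi2pi0 scale1r mul1r.
Qed.

(** The relations are homogeneous in each generator, so [e(t_i) U_i] satisfies
    them again inside [A] itself, and the universal property gives the map. *)
Lemma gauge_hom (t : 'I_n -> R) : exists2 f : A -> A, is_star_hom f &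
  forall k, f (W k) = e (\sum_i t i * (k 0 i)%:~R) *: W k.
Proof.
have rel' : nctorus_rel Theta (fun i => e (t i) *: U i).
  split=> [i|i j].
    have [su us] := hrel.1 i.
    split; rewrite starZ scale_mull scale_mulr scale_scale -expi2piN -expi2piD ?su ?us.
      by rewrite addNr expi2pi0 scale1r.
    by rewrite subrr expi2pi0 scale1r.
  by rewrite !scale_mull !scale_mulr !scale_scale hrel.2 !scale_scale; congr (_ *: _); rewrite -!expi2piD; congr e; ring.
have [[f hf fU] _] := hT.2 _ _ rel'; exists f => // k.
have [_ _ fM f1 _] := hf.
rewrite /monomial; elim: (index_enum _) => [|i r ih].
  by rewrite !big_nil f1 expi2pi0 scale1r.
by rewrite !big_cons fM ih hom_uexpz // fU uexpz_phase scale_mull scale_mulr scale_scale -expi2piD.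
Qed.

(** The nonzero frequencies are removed one at a time. For [k != 0] a suitable
    gauge automorphism [f] multiplies [W k] by [-1], so [x |-> (x + f x) / 2] kills
    [W k], fixes the scalars, and rescales the other coefficients; it does not
    increase the norm because [f] is contractive. *)
Lemma zero_coef_le (s : seq 'rV[int]_n) (y : 'rV[int]_n -> R[i]) (c : R[i]) :
  0 \notin s -> normc c <= cnorm (c *: (1 : A) + \sum_(k <- s) y k *: W k).
Proof.
elim: s y => [|k s ih] y; first by rewrite big_nil addr0 cnormZ cnorm1 mulr1.
rewrite in_cons negb_or eq_sym => /andP[k0 s0].
have [i ki] : exists i, k 0 i != 0.
  apply/existsP; rewrite -negb_forall; apply: contra k0 => /forallP h.
  by apply/eqP/rowP => i; rewrite mxE; apply/eqP.
(* This angle makes the gauge factor of [W k] equal to [e(1/2) = -1]. *)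
pose t j : R := if j == i then (2 * (k 0 i)%:~R)^-1 else 0.
have [f hf fW] := gauge_hom t; have [fD fZ fM f1 fs] := hf.
pose g l := e (t i * (l 0 i)%:~R).
have {}fW l : f (W l) = g l *: W l.
  rewrite fW (bigD1 i) //= big1 ?addr0 // => j ji.
  by rewrite /t (negPf ji) mul0r.
have gk : g k = -1.
  rewrite /g /t eqxx -expi2pi_half; congr e.
  by field; rewrite intr_eq0.
set X := _ + _.
have f0 : f 0 = 0 by have := fZ 0 0; rewrite !scale0r.
have fX : f X = c *: 1 + \sum_(l <- k :: s) (g l * y l) *: W l.
  rewrite fD fZ f1; congr (_ + _); rewrite (big_morph f fD f0).
  by apply: eq_bigr => l _; rewrite fZ fW scale_scale mulrC.
have := ih (fun l => (1 + g l) / 2 * y l) s0.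
have -> : c *: (1 : A) + \sum_(l <- s) ((1 + g l) / 2 * y l) *: W l =
   2^-1 *: (X + f X).
  have h2 v : 2^-1 *: (v + v) = v :> A.
    by rewrite -[v in v + v]scale1r -scalerDl scale_scale mulVf ?pnatr_eq0 // scale1r.
  rewrite fX /X addrACA scalerDr h2; congr (_ + _).
  rewrite -big_split big_cons /= gk mulN1r scaleNr subrr add0r scaler_sumr.
  apply: eq_bigr => l _; rewrite -scalerDl scale_scale; congr (_ *: _).
  by ring.
move=> /le_trans; apply; rewrite cnormZ normcV.
have -> : normc (2 : R[i]) = 2.
  by rewrite -(rmorph_nat (real_complex R)) normc_real ger0_norm.
rewrite ler_pdivrMl // (le_trans (cnormD _ _)) //.
by have := hom_contractive hf X; lra.
Qed.

End Torus.

(** * Numerical inequalities *)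
Section Numeric.
Variable R : realType.

(** An exponential factor [B ^+ j] is negligible against exponents [2 ^ j]. This
    is how constants and polynomially growing supports disappear when high powers
    are compared. *)
Lemma doubly_exp_growth (r s C B : R) : 0 <= r -> 0 <= s -> 1 <= B ->
  (forall j : nat, r ^+ (2 ^ j) <= C * B ^+ j * s ^+ (2 ^ j)) -> r <= s.
Proof.
move=> r0 s0 B1 h; rewrite leNgt; apply/negP => sr.
have B0 : 0 < B by lra.
have {}r0 : 0 < r by lra.
have {}s0 : 0 < s.
  rewrite lt_def s0 andbT; apply/eqP => se.
  by have := h 0%N; rewrite se expn0 !expr1 mulr0 leNgt r0.
pose t := s / r.
have t01 : 0 <= t < 1 by rewrite divr_ge0 ?(ltW r0) ?(ltW s0) //= ltr_pdivrMr // mul1r.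
have t0 : 0 < t by rewrite divr_gt0.
have hC j : 1 <= C * B ^+ j * t ^+ (2 ^ j).
  by rewrite expr_div_n mulrA ler_pdivlMr ?exprn_gt0 // mul1r.
have B2 : 0 < (2 * B)^-1 by rewrite invr_gt0 mulr_gt0.
(* Some power [t ^+ (2 ^ m)] beats [B] by a factor [2]; squaring it [i] more times
   then wins against [C * B ^+ (m + i)]. *)
have [m hm] := exp_small t01 B2.
have tm : t ^+ (2 ^ m) <= (2 * B)^-1.
  apply: le_trans (ltW hm); apply: ler_wiXn2l; rewrite ?(ltW t0) //; last exact/ltnW/ltn_expl.
  by case/andP: t01 => _ /ltW.
have C0 : 0 < C.
  by have := hC 0%N; rewrite expr0 mulr1; have := exprn_gt0 (2 ^ 0) t0; nra.
have CB : 0 < (C * B ^+ m)^-1 by rewrite invr_gt0 mulr_gt0 // exprn_gt0.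
have h01 : 0 <= (2^-1 : R) < 1 by apply/andP; split; lra.
have [i hi] := exp_small h01 CB.
have := hC (m + i)%N; rewrite expnD exprM.
suff : C * B ^+ (m + i) * (t ^+ (2 ^ m)) ^+ (2 ^ i) < 1 by lra.
apply: (@le_lt_trans _ _ (C * B ^+ (m + i) * (2 * B)^-1 ^+ i)).
  rewrite ler_pM2l ?mulr_gt0 ?exprn_gt0 //.
  apply: (@le_trans _ _ ((2 * B)^-1 ^+ (2 ^ i))).
    by rewrite lerXn2r ?nnegrE ?exprn_ge0 ?(ltW t0) ?(ltW B2).
  apply: ler_wiXn2l; [exact: ltW | | exact/ltnW/ltn_expl].
  by rewrite invf_le1; lra.
rewrite exprD -!mulrA -exprMn invfM [B * _]mulrCA mulfV ?mulr1 ?gt_eqF // mulrA.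
by rewrite mulrC -ltr_pdivlMr ?mulr_gt0 ?exprn_gt0 // mul1r.
Qed.

Lemma sum_Cauchy_Schwarz I (s : seq I) (a b : I -> R) :
  (\sum_(i <- s) a i * b i) ^+ 2 <= (\sum_(i <- s) a i ^+ 2) * (\sum_(i <- s) b i ^+ 2).
Proof.
elim: s => [|i s ih]; first by rewrite !big_nil mulr0 expr0n.
rewrite !big_cons.
have A0 : 0 <= \sum_(j <- s) a j ^+ 2 by apply: sumr_ge0 => j _; exact: sqr_ge0.
have B0 : 0 <= \sum_(j <- s) b j ^+ 2 by apply: sumr_ge0 => j _; exact: sqr_ge0.
move: (\sum_(j <- s) _ * _) (\sum_(j <- s) a j ^+ 2) (\sum_(j <- s) b j ^+ 2) ih A0 B0.
move: (a i) (b i) => x y S P Q ih P0 Q0.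
have h1 : 0 <= P * y ^+ 2 + Q * x ^+ 2 by rewrite addr_ge0 // mulr_ge0 ?sqr_ge0.
have h2 : (2 * S * x * y) ^+ 2 <= (P * y ^+ 2 + Q * x ^+ 2) ^+ 2.
  have : S ^+ 2 * (4 * (x * y) ^+ 2) <= P * Q * (4 * (x * y) ^+ 2).
    by rewrite ler_wpM2r // mulr_ge0 ?sqr_ge0.
  have := sqr_ge0 (P * y ^+ 2 - Q * x ^+ 2).
  rewrite -subr_ge0 => a1; rewrite -subr_ge0 => a2; rewrite -subr_ge0.
  have -> : (P * y ^+ 2 + Q * x ^+ 2) ^+ 2 - (2 * S * x * y) ^+ 2 =
    (P * y ^+ 2 - Q * x ^+ 2) ^+ 2 + (P * Q * (4 * (x * y) ^+ 2) - S ^+ 2 * (4 * (x * y) ^+ 2)) by ring.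
  by rewrite addr_ge0 // -subr_ge0.
have h3 : 2 * S * x * y <= P * y ^+ 2 + Q * x ^+ 2.
  rewrite (le_trans (ler_norm _)) // -(ger0_norm h1) -!sqrtr_sqr ler_sqrt //.
  exact: sqr_ge0.
rewrite -subr_ge0 in h3; rewrite -subr_ge0 in ih; rewrite -subr_ge0.
have -> : (x ^+ 2 + P) * (y ^+ 2 + Q) - (x * y + S) ^+ 2 =
  (P * y ^+ 2 + Q * x ^+ 2 - 2 * S * x * y) + (P * Q - S ^+ 2) by ring.
exact: addr_ge0.
Qed.

Lemma normc_ge0 (z : R[i]) : 0 <= normc z.
Proof. by case: z => x y; exact: sqrtr_ge0. Qed.

Lemma normcD (x y : R[i]) : normc (x + y) <= normc x + normc y.
Proof. exact: le_normcD. Qed.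

Lemma normc_conjc (x : R[i]) : normc (conjc x) = normc x.
Proof. by case: x => a b /=; rewrite sqrrN. Qed.

Lemma mul_conjc_normc (x : R[i]) : conjc x * x = (normc x ^+ 2)%:C.
Proof. by rewrite mulrC -sqr_normc rmorphXn /= normc_def; case: x. Qed.

Lemma normc_sum I (s : seq I) (P : pred I) (F : I -> R[i]) :
  normc (\sum_(i <- s | P i) F i) <= \sum_(i <- s | P i) normc (F i).
Proof.
elim/big_rec2: _ => [|i u v _ h]; first by rewrite normc0.
by rewrite (le_trans (normcD _ _)) // lerD2l.
Qed.

Lemma normc_Cauchy_Schwarz I (s : seq I) (a b : I -> R[i]) :
  normc (\sum_(i <- s) a i * b i) ^+ 2 <=
  (\sum_(i <- s) normc (a i) ^+ 2) * (\sum_(i <- s) normc (b i) ^+ 2).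
Proof.
apply: le_trans (sum_Cauchy_Schwarz s (fun i => normc (a i)) (fun i => normc (b i))).
rewrite lerXn2r ?nnegrE ?normc_ge0 //.
  by apply: sumr_ge0 => i _; rewrite mulr_ge0 ?normc_ge0.
apply: (le_trans (normc_sum _ _ _)).
by apply: ler_sum => i _; rewrite normcM.
Qed.

Lemma Re_le_normc (z : R[i]) : complex.Re z <= normc z.
Proof. by rewrite -lecR (le_trans _ (normc_ge_Re z)) ?lecR ?ler_norm // normc_def; case: z. Qed.

End Numeric.

(** * The canonical trace and the norm of trigonometric polynomials *)
Section Box.
Variable n : nat.
Implicit Types k l : 'rV[int]_n.

(** The cube of side [2 r + 1] centred at [0]. Its polynomial cardinality in [r]
    is what makes the [l^1] and [l^2] norms of coefficients comparable below. *)
Definition box (r : nat) : seq 'rV[int]_n :=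
  [seq \row_i ((f i : nat)%:Z - r%:Z) | f : {ffun 'I_n -> 'I_(r + r).+1}].

Lemma mem_box r k : (k \in box r) = [forall i, `|k 0 i| <= r%:Z].
Proof.
apply/imageP/forallP => [[f _ ->] i|h].
  by rewrite mxE; case: (f i) => m /= hm; lia.
exists [ffun i => inord (absz (k 0 i + r%:Z))] => //.
apply/rowP => i; rewrite mxE ffunE; move: (h i); move: (k 0 i) => x hx.
by rewrite inordK; lia.
Qed.

Lemma uniq_box r : uniq (box r).
Proof.
rewrite map_inj_uniq ?enum_uniq // => f g /rowP h; apply/ffunP => i.
by have := h i; rewrite !mxE => h'; apply: val_inj => /=; lia.
Qed.

Lemma size_box r : size (box r) = ((r + r).+1 ^ n)%N.
Proof. by rewrite size_map -cardE card_ffun !card_ord. Qed.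

Lemma box_le r r' k : (r <= r')%N -> k \in box r -> k \in box r'.
Proof.
by rewrite !mem_box => rr /forallP h; apply/forallP => i; move: (h i); move: (k 0 i) => x; lia.
Qed.

Lemma box0 r : 0 \in box r.
Proof. by rewrite mem_box; apply/forallP => i; rewrite mxE; lia. Qed.

Lemma boxD r r' k l : k \in box r -> l \in box r' -> k + l \in box (r + r').
Proof.
rewrite !mem_box => /forallP h /forallP h'; apply/forallP => i.
by rewrite mxE; move: (h i) (h' i); move: (k 0 i) (l 0 i) => x x'; lia.
Qed.

Lemma boxN r k : k \in box r -> - k \in box r.
Proof.
by rewrite !mem_box => /forallP h; apply/forallP => i; rewrite mxE; move: (h i); move: (k 0 i) => x; lia.
Qed.

Lemma box_exists k : exists r, k \in box r.
Proof.
exists (\sum_i absz (k 0%R i))%N; rewrite mem_box; apply/forallP => i.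
by rewrite (bigD1 i) //=; move: (k 0 i) => x; lia.
Qed.

End Box.

Section Span.
Variables (R : realType) (n : nat) (Theta : 'M[R]_n) (A : cstarAlgType R) (U : 'I_n -> A).
Hypothesis hT : is_nctorus Theta U.
Local Notation W := (monomial U).
Local Notation e := (@expi2pi R).
Local Notation phi := (twist Theta (all_pairs n)).
Implicit Types (X Y Z : A) (k l : 'rV[int]_n) (y : 'rV[int]_n -> R[i]).

Definition box_sum r y : A := \sum_(k <- box n r) y k *: W k.
Definition box_span r X := exists y, X = box_sum r y.

Lemma box_spanD r X Y : box_span r X -> box_span r Y -> box_span r (X + Y).
Proof.
move=> [y ->] [y' ->]; exists (fun k => y k + y' k).
by rewrite -big_split; apply: eq_bigr => k _; rewrite scalerDl.
Qed.

Lemma box_spanZ r c X : box_span r X -> box_span r (c *: X).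
Proof.
move=> [y ->]; exists (fun k => c * y k).
by rewrite /box_sum scaler_sumr; apply: eq_bigr => k _; rewrite scale_scale.
Qed.

Lemma box_span0 r : box_span r 0.
Proof. by exists (fun=> 0); rewrite /box_sum big1 // => k _; rewrite scale0r. Qed.

Lemma box_span_sum r I (s : seq I) (P : pred I) (F : I -> A) :
  (forall i, P i -> box_span r (F i)) -> box_span r (\sum_(i <- s | P i) F i).
Proof. by move=> h; elim/big_ind: _ => //; [exact: box_span0|exact: box_spanD]. Qed.

Lemma box_span_monomial r k : k \in box n r -> box_span r (W k).
Proof.
move=> kr; exists (fun l => (l == k)%:R).
rewrite /box_sum (bigD1_seq k) ?uniq_box //= eqxx scale1r big1 ?addr0 // => l /negPf ->.
by rewrite scale0r.
Qed.

Lemma box_span_le r r' X : (r <= r')%N -> box_span r X -> box_span r' X.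
Proof.
move=> rr [y ->]; rewrite /box_sum big_seq; apply: box_span_sum => k kr.
exact/box_spanZ/box_span_monomial/(box_le rr).
Qed.

Lemma box_spanM r r' X Y : box_span r X -> box_span r' Y -> box_span (r + r') (X * Y).
Proof.
move=> [y ->] [y' ->]; rewrite /box_sum mulr_suml big_seq; apply: box_span_sum => k kr.
rewrite mulr_sumr big_seq; apply: box_span_sum => l lr.
rewrite scale_mull scale_mulr (monomialM hT) scale_scale scale_scale; apply/box_spanZ/box_span_monomial.
exact: boxD.
Qed.

Lemma box_span_star r X : box_span r X -> box_span r (star X).
Proof.
move=> [y ->]; rewrite /box_sum star_sum big_seq; apply: box_span_sum => k kr.
by rewrite starZ (star_monomial hT) scale_scale; apply/box_spanZ/box_span_monomial/boxN.
Qed.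

Lemma box_span1 r : box_span r 1.
Proof. by rewrite -(monomial0 U); exact/box_span_monomial/box0. Qed.

Lemma box_spanX r X m : box_span r X -> box_span (m * r) (X ^+ m).
Proof.
move=> h; elim: m => [|m ih]; first by rewrite expr0; exact: box_span1.
by rewrite exprS mulSn; exact: box_spanM.
Qed.

Definition trig_poly X := exists r, box_span r X.

Lemma trig_polyM X Y : trig_poly X -> trig_poly Y -> trig_poly (X * Y).
Proof. by move=> [r hX] [r' hY]; exists (r + r')%N; exact: box_spanM. Qed.

Lemma trig_poly_star X : trig_poly X -> trig_poly (star X).
Proof. by move=> [r hX]; exists r; exact: box_span_star. Qed.

Lemma trig_polyX X m : trig_poly X -> trig_poly (X ^+ m).
Proof. by move=> [r hX]; exists (m * r)%N; exact: box_spanX. Qed.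

Lemma trig_poly_common X Y : trig_poly X -> trig_poly Y ->
  exists r, box_span r X /\ box_span r Y.
Proof.
move=> [r hX] [r' hY]; exists (maxn r r').
by split; [apply: box_span_le hX; exact: leq_maxl|apply: box_span_le hY; exact: leq_maxr].
Qed.

Lemma trig_polyD X Y : trig_poly X -> trig_poly Y -> trig_poly (X + Y).
Proof.
by move=> hX hY; have [r [? ?]] := trig_poly_common hX hY; exists r; exact: box_spanD.
Qed.

Lemma trig_polyZ c X : trig_poly X -> trig_poly (c *: X).
Proof. by move=> [r hX]; exists r; exact: box_spanZ. Qed.

Lemma trig_poly_monomial k : trig_poly (W k).
Proof. by have [r kr] := box_exists k; exists r; exact: box_span_monomial. Qed.

Lemma trig_poly_sum I (s : seq I) (F : I -> A) :
  (forall i, trig_poly (F i)) -> trig_poly (\sum_(i <- s) F i).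
Proof.
by move=> h; elim/big_ind: _ => //; [exists 0%N; exact: box_span0|exact: trig_polyD].
Qed.

Lemma box_sum_coef0_le r y : normc (y 0) <= cnorm (box_sum r y).
Proof.
have := @zero_coef_le R n Theta A U hT (filter (predC1 0) (box n r)) y (y 0).
rewrite mem_filter /= eqxx => /(_ isT) /le_trans; apply.
rewrite big_filter [X in _ <= cnorm X](bigD1_seq 0) ?uniq_box ?box0 //=.
by rewrite [monomial U 0](monomial0 U).
Qed.

(** The functional taking the zeroth Fourier coefficient. It is determined on
    trigonometric polynomials because that coefficient is bounded by the norm; its
    value elsewhere is a dummy. *)
Definition trace X : R[i] := xget 0 [set c | exists r y, X = box_sum r y /\ c = y 0].

Lemma box_sum_widen r r' y : (r <= r')%N ->
  box_sum r y = box_sum r' (fun k => if k \in box n r then y k else 0).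
Proof.
move=> rr; rewrite /box_sum.
rewrite [RHS](bigID (mem (box n r))) /= [X in _ = _ + X]big1 ?addr0; last first.
  by move=> k /negPf ->; rewrite scale0r.
rewrite -[RHS]big_filter.
rewrite [RHS](perm_big (box n r)) /=.
  by apply: eq_big_seq => k /= ->.
apply: uniq_perm; rewrite ?filter_uniq ?uniq_box // => k.
rewrite mem_filter; case: (boolP (k \in box n r)) => //= kr.
exact: box_le kr.
Qed.

(** Two expansions of the same element over boxes differ, on a common box, by an
    expansion of [0], whose zeroth coefficient is bounded by [cnorm 0]. *)
Lemma traceE r y : trace (box_sum r y) = y 0.
Proof.
rewrite /trace; case: xgetP => [c _ [r' [y' [E ->]]]|/(_ (y 0)) []]; last first.
  by exists r, y.
have : normc (y 0 - y' 0) <= 0.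
  pose m := maxn r r'.
  pose d k := (if k \in box n r then y k else 0) - (if k \in box n r' then y' k else 0).
  have := box_sum_coef0_le m d; rewrite /d !box0 => /le_trans; apply.
  suff -> : box_sum m d = 0 by rewrite cnorm0.
  transitivity (box_sum r y - box_sum r' y'); last by rewrite E subrr.
  rewrite (box_sum_widen y (leq_maxl r r')) (box_sum_widen y' (leq_maxr r r')) -/m.
  rewrite /box_sum -sumrB; apply: eq_bigr => k _; exact: scalerBl.
move=> h; apply/eqP; rewrite eq_sym -subr_eq0; apply/eqP/eq0_normc.
by apply/eqP; rewrite eq_le h normc_ge0.
Qed.

Lemma traceD X Y : trig_poly X -> trig_poly Y -> trace (X + Y) = trace X + trace Y.
Proof.
move=> hX hY; have [r [[y ->] [y' ->]]] := trig_poly_common hX hY.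
rewrite !traceE; transitivity (trace (box_sum r (fun k => y k + y' k))); last exact: traceE.
congr trace; rewrite /box_sum -big_split; apply: eq_bigr => k _.
by rewrite scalerDl.
Qed.

Lemma traceZ c X : trig_poly X -> trace (c *: X) = c * trace X.
Proof.
move=> [r [y ->]]; rewrite traceE.
transitivity (trace (box_sum r (fun k => c * y k))); last exact: traceE.
congr trace; rewrite /box_sum scaler_sumr; apply: eq_bigr => k _.
by rewrite scale_scale.
Qed.

Lemma trace0 : trace 0 = 0.
Proof.
rewrite -(traceE 0 (fun=> 0)); congr trace.
by rewrite /box_sum big1 // => k _; rewrite scale0r.
Qed.

Lemma trace_sum I (s : seq I) (F : I -> A) :
  (forall i, trig_poly (F i)) -> trace (\sum_(i <- s) F i) = \sum_(i <- s) trace (F i).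
Proof.
move=> h; elim: s => [|i s ih]; first by rewrite !big_nil trace0.
by rewrite !big_cons traceD ?ih //; exact: trig_poly_sum.
Qed.

Lemma trace_monomial k : trace (W k) = (k == 0)%:R.
Proof.
have [r kr] := box_exists k.
have -> : W k = box_sum r (fun l => (l == k)%:R).
  rewrite /box_sum (bigD1_seq k) ?uniq_box //= eqxx scale1r big1 ?addr0 // => l /negPf ->.
  by rewrite scale0r.
by rewrite traceE eq_sym.
Qed.

Lemma normc_trace_le X : trig_poly X -> normc (trace X) <= cnorm X.
Proof. by move=> [r [y ->]]; rewrite traceE; exact: box_sum_coef0_le. Qed.

Lemma trace_star_monomial k l : trace (star (W k) * W l) = (k == l)%:R.
Proof.
have [<-|kl] := eqVneq k l.
  by rewrite (monomial_unitary hT k).1 -(monomial0 U) trace_monomial eqxx.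
rewrite (star_monomial hT) scale_mull (monomialM hT) scale_scale traceZ; last exact: trig_poly_monomial.
by rewrite trace_monomial addrC subr_eq0 eq_sym (negPf kl) mulr0.
Qed.

(** Parseval: the monomials are orthonormal for the inner product of the trace. *)
Lemma trace_star_mul (s : seq 'rV[int]_n) y y' : uniq s ->
  trace (star (\sum_(k <- s) y k *: W k) * (\sum_(k <- s) y' k *: W k)) =
  \sum_(k <- s) conjc (y k) * y' k.
Proof.
move=> us; rewrite star_sum mulr_suml.
have tp k l : trig_poly (star (W k) * W l).
  by apply: trig_polyM; [apply: trig_poly_star|]; exact: trig_poly_monomial.
have tp' k l : trig_poly (star (y k *: W k) * (y' l *: W l)).
  by rewrite starZ scale_mull scale_mulr; do 2 apply: trig_polyZ; exact: tp.
rewrite trace_sum; last first.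
  by move=> k; rewrite mulr_sumr; exact: trig_poly_sum.
rewrite big_seq [RHS]big_seq; apply: eq_bigr => k ks.
rewrite mulr_sumr trace_sum // (bigD1_seq k) //= big1 ?addr0.
  rewrite starZ scale_mull scale_mulr !traceZ ?trace_star_monomial ?eqxx ?mulr1 //.
  exact: trig_polyZ.
move=> l lk; rewrite starZ scale_mull scale_mulr !traceZ ?trace_star_monomial //; last exact: trig_polyZ.
by rewrite eq_sym (negPf lk) !mulr0.
Qed.

Definition sqnorm2 X : R := complex.Re (trace (star X * X)).

Lemma sqnorm2E (s : seq 'rV[int]_n) y : uniq s ->
  sqnorm2 (\sum_(k <- s) y k *: W k) = \sum_(k <- s) normc (y k) ^+ 2.
Proof.
move=> us; rewrite /sqnorm2 trace_star_mul //.
under eq_bigr => k _ do rewrite mul_conjc_normc.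
by rewrite -rmorph_sum.
Qed.

Lemma sqnorm2_ge0 X : trig_poly X -> 0 <= sqnorm2 X.
Proof.
move=> [r [y ->]]; rewrite sqnorm2E ?uniq_box //.
by apply: sumr_ge0 => k _; exact: sqr_ge0.
Qed.

Lemma sqnorm2_le X : trig_poly X -> sqnorm2 X <= cnorm X ^+ 2.
Proof.
move=> hX; rewrite -cnormMstar (le_trans (Re_le_normc _)) //.
by apply: normc_trace_le; apply: trig_polyM => //; exact: trig_poly_star.
Qed.

Lemma trace_Cauchy_Schwarz X Y : trig_poly X -> trig_poly Y ->
  complex.Re (trace (star X * Y)) ^+ 2 <= sqnorm2 X * sqnorm2 Y.
Proof.
move=> hX hY; have [r [[y ->] [y' ->]]] := trig_poly_common hX hY.
rewrite !sqnorm2E ?uniq_box // trace_star_mul ?uniq_box //.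
have h : forall z : R[i], complex.Re z ^+ 2 <= normc z ^+ 2.
  move=> [a b] /=; rewrite sqr_sqrtr ?addr_ge0 ?sqr_ge0 //.
  by rewrite lerDl sqr_ge0.
apply: (le_trans (h _)); apply: (le_trans (normc_Cauchy_Schwarz _ _ _)).
by under eq_bigr => k _ do rewrite normc_conjc.
Qed.

(** Each monomial has norm [1], so the norm is at most the [l^1] norm of the
    coefficients, and Cauchy-Schwarz over the points of the box does the rest. *)
Lemma cnorm_le_sqnorm2 r X : box_span r X -> cnorm X ^+ 2 <= ((r + r).+1 ^ n)%:R * sqnorm2 X.
Proof.
move=> [y ->]; rewrite sqnorm2E ?uniq_box // -size_box.
have h : cnorm (box_sum r y) <= \sum_(k <- box n r) 1 * normc (y k).
  apply: (le_trans (cnorm_sum _ _ _)); apply: ler_sum => k _.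
  by rewrite cnormZ (cnorm_monomial hT) mulr1 mul1r.
apply: (@le_trans _ _ ((\sum_(k <- box n r) 1 * normc (y k)) ^+ 2)).
  by rewrite lerXn2r ?nnegrE ?cnorm_ge0 //; exact: le_trans (cnorm_ge0 _) h.
apply: (le_trans (sum_Cauchy_Schwarz _ _ _)); rewrite expr1n big_const_seq count_predT.
by rewrite iter_addr_0.
Qed.

(** Put [h = star X * X] and [b j = trace (star Y * h ^+ (2 ^ j) * Y)]. The
    Cauchy-Schwarz inequality gives [b j ^+ 2 <= sqnorm2 Y * b j.+1], so
    [b 0 / sqnorm2 Y] is at most the [2 ^ j]-th root of [b j / sqnorm2 Y], while
    [b j] grows at most like [cnorm X ^+ 2] to the power [2 ^ j]. Thus left
    multiplication, for the inner product of the trace, has norm at most [cnorm X], without any positivity theory for C*-algebras. *)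
Lemma sqnorm2M X Y : trig_poly X -> trig_poly Y ->
  sqnorm2 (X * Y) <= cnorm X ^+ 2 * sqnorm2 Y.
Proof.
move=> hX hY.
pose h := star X * X.
have hh : trig_poly h by apply: trig_polyM => //; exact: trig_poly_star.
have sh : star h = h by rewrite starM starK.
pose b j := complex.Re (trace (star Y * (h ^+ (2 ^ j) * Y))).
have hb j : b j ^+ 2 <= sqnorm2 Y * b j.+1.
  have := trace_Cauchy_Schwarz hY (trig_polyM (trig_polyX (2 ^ j) hh) hY).
  rewrite {2}/sqnorm2; have -> // : star (h ^+ (2 ^ j) * Y) * (h ^+ (2 ^ j) * Y) =
    star Y * (h ^+ (2 ^ j.+1) * Y).
  by rewrite starM starX sh -mulrA (mulrA (h ^+ _)) -exprD addnn -mul2n -expnS.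
have bE : sqnorm2 (X * Y) = b 0%N.
  by rewrite /sqnorm2 /b expn0 expr1 starM /h !mulrA.
have bC j : b j <= cnorm Y ^+ 2 * (cnorm X ^+ 2) ^+ (2 ^ j).
  apply: (le_trans (Re_le_normc _)).
  apply: (le_trans (normc_trace_le _)).
    apply: trig_polyM; first exact: trig_poly_star.
    by apply: trig_polyM => //; exact: trig_polyX.
  apply: (le_trans (cnormM _ _)); rewrite cnorm_star.
  rewrite expr2 -mulrA ler_wpM2l ?cnorm_ge0 // mulrC.
  apply: (le_trans (cnormM _ _)).
  by rewrite (cnorm_selfadj_exp2 _ sh) /h cnormMstar.
have q0 := sqnorm2_ge0 hY.
have b0 : 0 <= b 0%N by rewrite -bE; apply: sqnorm2_ge0; exact: trig_polyM.
rewrite bE.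
have [qe|qn] := eqVneq (sqnorm2 Y) 0.
  rewrite qe mulr0; have := hb 0%N; rewrite qe mul0r => h0.
  by have := sqr_ge0 (b 0%N); nra.
have qp : 0 < sqnorm2 Y by rewrite lt_def qn.
rewrite -ler_pdivrMr //.
have key j : (b 0%N / sqnorm2 Y) ^+ (2 ^ j) <= b j / sqnorm2 Y.
  elim: j => [|j ih]; first by rewrite expr1.
  rewrite expnSr exprM.
  apply: (@le_trans _ _ ((b j / sqnorm2 Y) ^+ 2)).
    have p0 : 0 <= (b 0%N / sqnorm2 Y) ^+ (2 ^ j) by rewrite exprn_ge0 // divr_ge0.
    by rewrite lerXn2r ?nnegrE // (le_trans p0).
  by rewrite expr_div_n ler_pdivrMr ?exprn_gt0 // [sqnorm2 Y ^+ 2]expr2 mulrA divfK // mulrC hb.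
apply: (@doubly_exp_growth R _ _ (cnorm Y ^+ 2 / sqnorm2 Y) 1) => //.
- by rewrite divr_ge0.
- exact: sqr_ge0.
- move=> j; rewrite expr1n mulr1; apply: (le_trans (key j)).
  by rewrite mulrAC ler_pM2r ?invr_gt0.
Qed.

(** The converse of the previous bound: the left regular representation does not
    decrease norms. With [h = star X * X], the element [h ^+ (2 ^ j)] is supported
    in a box of radius proportional to [2 ^ j], so its norm is at most a polynomial
    in [2 ^ j] times its trace norm, which is at most [K] to the power [2 ^ j.+1].
    Taking [2 ^ j]-th roots removes the polynomial. *)
Lemma cnorm_le_opnorm2 X K : trig_poly X -> 0 <= K ->
  (forall Y, trig_poly Y -> sqnorm2 (X * Y) <= K ^+ 2 * sqnorm2 Y) -> cnorm X <= K.
Proof.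
move=> hX K0 hK.
have hsX := trig_poly_star hX.
(* The adjoint kernel obeys the same bound. *)
have hsK Y : trig_poly Y -> sqnorm2 (star X * Y) <= K ^+ 2 * sqnorm2 Y.
  move=> hY; set Z := star X * Y.
  have hZ : trig_poly Z by exact: trig_polyM.
  have ZE : sqnorm2 Z = complex.Re (trace (star Y * (X * Z))).
    by rewrite /sqnorm2 {1}/Z starM starK mulrA.
  have := trace_Cauchy_Schwarz hY (trig_polyM hX hZ); rewrite -ZE => h1.
  have h2 := hK _ hZ; have y0 := sqnorm2_ge0 hY; have z0 := sqnorm2_ge0 hZ.
  have [ze|zn] := eqVneq (sqnorm2 Z) 0; first by rewrite ze mulr_ge0 // sqr_ge0.
  have zp : 0 < sqnorm2 Z by rewrite lt_def zn.
  rewrite -(ler_pM2r zp) -expr2 (le_trans h1) // mulrC [leRHS]mulrAC.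
  by rewrite ler_wpM2r.
pose h := star X * X.
have sh : star h = h by rewrite starM starK.
have hh m : sqnorm2 (h ^+ m) <= (K ^+ 4) ^+ m.
  elim: m => [|m ih].
    rewrite !expr0 (le_trans (sqnorm2_le _)) ?cnorm1 ?expr1n //.
    by exists 0%N; exact: box_span1.
  have hm : trig_poly (h ^+ m) by apply: trig_polyX; exact: trig_polyM.
  rewrite exprS -mulrA (le_trans (hsK _ _)) //; first exact: trig_polyM.
  have K4 : K ^+ 4 = K ^+ 2 * K ^+ 2 by rewrite -exprD.
  rewrite [leRHS]exprS {1}K4 -mulrA ler_wpM2l ?sqr_ge0 //.
  by rewrite (le_trans (hK _ hm)) // ler_wpM2l ?sqr_ge0.
have [r hr] := trig_polyM hsX hX.
suff : cnorm h ^+ 2 <= K ^+ 4.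
  rewrite cnormMstar -exprM.
  by rewrite ler_pXn2r ?nnegrE ?cnorm_ge0.
apply: (@doubly_exp_growth R _ _ ((r + r).+1 ^ n)%:R (2 ^ n)%:R).
- exact: sqr_ge0.
- exact: exprn_ge0.
- by rewrite ler1n expn_gt0.
move=> j; rewrite -exprM mulnC exprM -(cnorm_selfadj_exp2 _ sh).
apply: (le_trans (cnorm_le_sqnorm2 (box_spanX (2 ^ j) hr))).
apply: ler_pM; rewrite ?ler0n ?sqnorm2_ge0 //.
  by apply: trig_polyX; exact: trig_polyM.
have monoX a b m : (a <= b -> a ^ m <= b ^ m)%N.
  by case: m => // m ab; rewrite leq_exp2r.
rewrite -natrX -natrM ler_nat -expnM [(n * j)%N]mulnC expnM -expnMn monoX //.
by have := expn_gt0 2 j; nia.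
Qed.

End Span.

(** * Twisted convolution kernels and Schur multipliers *)
Section L2Bounded.
Variables (R : realType) (I : eqType).
Implicit Types (M : I -> I -> R[i]) (K : R) (s t : seq I) (y : I -> R[i]).

(** The matrix [M] acts on [l^2] of [I] with operator norm at most [K], tested on
    finite sections so that no infinite sum is needed. *)
Definition l2_bounded M K := forall s t y, uniq s -> uniq t ->
  \sum_(i <- t) normc (\sum_(j <- s) M i j * y j) ^+ 2 <=
  K ^+ 2 * \sum_(j <- s) normc (y j) ^+ 2.

Lemma sum_sqnorm_ge0 s y : 0 <= \sum_(j <- s) normc (y j) ^+ 2.
Proof. by apply: sumr_ge0 => j _; exact: sqr_ge0. Qed.

Lemma eq_l2_bounded M M' K : (forall i j, M i j = M' i j) -> l2_bounded M K -> l2_bounded M' K.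
Proof.
move=> E h s t y us ut; apply: le_trans (h s t y us ut).
rewrite le_eqVlt; apply/orP; left; apply/eqP; apply: eq_bigr => i _.
by congr (normc _ ^+ 2); apply: eq_bigr => j _; rewrite E.
Qed.

Lemma l2_bounded_le M K K' : 0 <= K -> K <= K' -> l2_bounded M K -> l2_bounded M K'.
Proof.
move=> K0 KK h s t y us ut; apply: (le_trans (h s t y us ut)).
by rewrite ler_wpM2r ?sum_sqnorm_ge0 // lerXn2r // nnegrE // (le_trans K0).
Qed.

Lemma l2_boundedD M M' K K' : 0 <= K -> 0 <= K' -> l2_bounded M K -> l2_bounded M' K' ->
  l2_bounded (fun i j => M i j + M' i j) (K + K').
Proof.
move=> K0 K0' h h' s t y us ut.
have := h s t y us ut; have := h' s t y us ut.
set p := fun i => \sum_(j <- s) M i j * y j; set p' := fun i => \sum_(j <- s) M' i j * y j.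
set N := \sum_(j <- s) _ => hP' hP.
have N0 : 0 <= N by exact: sum_sqnorm_ge0.
have -> : \sum_(i <- t) normc (\sum_(j <- s) (M i j + M' i j) * y j) ^+ 2 =
  \sum_(i <- t) normc (p i + p' i) ^+ 2.
  apply: eq_bigr => i _; congr (normc _ ^+ 2); rewrite -big_split.
  by apply: eq_bigr => j _; rewrite mulrDl.
apply: (@le_trans _ _ (\sum_(i <- t) (normc (p i) ^+ 2 + normc (p' i) ^+ 2 +
    2 * (normc (p i) * normc (p' i))))).
  apply: ler_sum => i _; have := normcD (p i) (p' i).
  have := normc_ge0 (p i + p' i); have := normc_ge0 (p i); have := normc_ge0 (p' i).
  by nra.
rewrite !big_split /= -mulr_sumr.
have := sum_Cauchy_Schwarz t (fun i => normc (p i)) (fun i => normc (p' i)).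
 set Q := \sum_(i <- t) _ * _ => hQ.
have : Q <= K * K' * N.
  have Q0 : 0 <= Q by apply: sumr_ge0 => i _; rewrite mulr_ge0 ?normc_ge0.
  rewrite -(@ler_pXn2r _ 2) ?nnegrE ?mulr_ge0 // (le_trans hQ) //.
  have -> : (K * K' * N) ^+ 2 = (K ^+ 2 * N) * (K' ^+ 2 * N) by ring.
  by apply: ler_pM => //; exact: sum_sqnorm_ge0.
have -> : (K + K') ^+ 2 * N = K ^+ 2 * N + K' ^+ 2 * N + 2 * (K * K' * N) by ring.
lra.
Qed.

(** The entrywise multiplier is the Gram matrix of vectors of length at most [1]
    with coordinates [u x i] and [v x j]. Applying [M] to [v x * y] separately for
    each [x] and recombining with the weights [u x] costs nothing, by
    Cauchy-Schwarz in [x]. *)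
Lemma schur_multiplier M K s t y (J : Type) (X : seq J) (u v : J -> I -> R[i]) :
  l2_bounded M K -> uniq s -> uniq t ->
  (forall i, i \in t -> \sum_(x <- X) normc (u x i) ^+ 2 <= 1) ->
  (forall j, j \in s -> \sum_(x <- X) normc (v x j) ^+ 2 <= 1) ->
  \sum_(i <- t) normc (\sum_(j <- s) (\sum_(x <- X) u x i * v x j) * M i j * y j) ^+ 2 <=
  K ^+ 2 * \sum_(j <- s) normc (y j) ^+ 2.
Proof.
move=> hM us ut hu hv.
pose w x i := \sum_(j <- s) M i j * (v x j * y j).
apply: (@le_trans _ _ (\sum_(i <- t) \sum_(x <- X) normc (w x i) ^+ 2)).
  rewrite big_seq [leRHS]big_seq; apply: ler_sum => i it.
  have -> : \sum_(j <- s) (\sum_(x <- X) u x i * v x j) * M i j * y j =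
      \sum_(x <- X) u x i * w x i.
    rewrite /w; under [RHS]eq_bigr => x _ do rewrite mulr_sumr.
    rewrite exchange_big /=; apply: eq_bigr => j _.
    rewrite -mulrA mulr_suml; apply: eq_bigr => x _.
    by ring.
  apply: (le_trans (normc_Cauchy_Schwarz _ _ _)).
  rewrite -[leRHS]mul1r ler_wpM2r ?hu //.
  by apply: sumr_ge0 => x _; exact: sqr_ge0.
rewrite exchange_big /=.
apply: (@le_trans _ _ (\sum_(x <- X) K ^+ 2 * \sum_(j <- s) normc (v x j * y j) ^+ 2)).
  by apply: ler_sum => x _; exact: hM.
rewrite -mulr_sumr ler_wpM2l ?sqr_ge0 // exchange_big /=.
rewrite big_seq [leRHS]big_seq; apply: ler_sum => j js.
under eq_bigr => x _ do rewrite normcM exprMn.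
by rewrite -mulr_suml -[leRHS]mul1r ler_wpM2r ?sqr_ge0 // hv.
Qed.

End L2Bounded.

Section Kernel.
Variables (R : realType) (n : nat).
Local Notation e := (@expi2pi R).
Implicit Types (phi : 'rV[int]_n -> 'rV[int]_n -> R) (a : 'rV[int]_n -> R[i]).

(** The matrix of twisted convolution by [a]: if [phi] is the exponent of the
    cocycle of the monomials [W], then [W k * W j] contributes to row [k + j]. *)
Definition twisted_kernel phi a (i j : 'rV[int]_n) : R[i] := e (phi (i - j) j) * a (i - j).

Lemma l2_bounded_kernel_l1 phi a c :
  (forall F, uniq F -> \sum_(k <- F) normc (a k) <= c) ->
  l2_bounded (twisted_kernel phi a) c.
Proof.
move=> ha s t y us ut.
have c0 : 0 <= c by have := ha [::] isT; rewrite big_nil.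
apply: (@le_trans _ _ (\sum_(i <- t) c * \sum_(j <- s) normc (a (i - j)) * normc (y j) ^+ 2)).
  apply: ler_sum => i _.
  pose b j := Num.sqrt (normc (a (i - j))).
  have bb j : b j ^+ 2 = normc (a (i - j)) by rewrite sqr_sqrtr ?normc_ge0.
  apply: (@le_trans _ _ ((\sum_(j <- s) b j * (b j * normc (y j))) ^+ 2)).
    have h : normc (\sum_(j <- s) twisted_kernel phi a i j * y j) <=
        \sum_(j <- s) b j * (b j * normc (y j)).
      apply: (le_trans (normc_sum _ _ _)); apply: ler_sum => j _.
      by rewrite !normcM normc_expi2pi mul1r mulrA -expr2 bb.
    by rewrite lerXn2r ?nnegrE ?normc_ge0 // (le_trans _ h) ?normc_ge0.
  apply: (le_trans (sum_Cauchy_Schwarz _ _ _)).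
  under eq_bigr do rewrite bb.
  under [X in _ * X <= _]eq_bigr do rewrite exprMn bb.
  rewrite ler_wpM2r //.
    by apply: sumr_ge0 => j _; rewrite mulr_ge0 ?normc_ge0 ?sqr_ge0.
  have := ha [seq i - j | j <- s]; rewrite big_map; apply.
  by rewrite map_inj_uniq // => j j' /addrI/oppr_inj.
rewrite -mulr_sumr expr2 -mulrA ler_wpM2l // exchange_big /= mulr_sumr.
apply: ler_sum => j _; rewrite -mulr_suml ler_wpM2r ?sqr_ge0 //.
have := ha [seq i - j | i <- t]; rewrite big_map; apply.
by rewrite map_inj_uniq // => i i' /addIr.
Qed.

Definition in_window (N : nat) (x : int) := (0 <= x) && (x < N%:Z).

Lemma window_sum (V : nmodType) (N : nat) (X : seq int) (c : int) (G : int -> V) :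
  uniq X -> (forall t, (t < N)%N -> c + t%:Z \in X) ->
  \sum_(x <- X | in_window N (x - c)) G x = \sum_(t < N) G (c + t%:Z).
Proof.
move=> uX hX; rewrite -big_filter (perm_big [seq c + t%:Z | t <- iota 0 N]).
  by rewrite big_map -(big_mkord xpredT (fun t => G (c + t%:Z))) /index_iota subn0.
apply: uniq_perm; first exact: filter_uniq.
  by rewrite map_inj_uniq ?iota_uniq // => x y /addrI [].
move=> x; rewrite mem_filter; apply/andP/mapP => [[/andP [x0 xN] _]|[t]].
  exists (absz (x - c)); last by lia.
  by rewrite mem_iota; lia.
rewrite mem_iota => /andP[_ tN] ->; split; first by rewrite /in_window; lia.
by apply: hX.
Qed.

Lemma window_exit_count (N : nat) (c : int) :
  \sum_(t < N) (~~ in_window N (t%:Z - c) : nat)%:R <= (`|c|)%:~R :> R.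
Proof.
rewrite -natr_sum.
suff h : (\sum_(t < N) (~~ in_window N (t%:Z - c)) <= absz c)%N.
  by rewrite -abszE -[_%:~R]/((absz c)%:R) ler_nat.
case: c => c.
  have h M : (M <= N)%N -> (\sum_(t < M) (~~ in_window N (t%:Z - c%:Z)) <= minn M c)%N.
    elim: M => [|M ih] MN; first by rewrite big_ord0.
    rewrite big_ord_recr /=; have := ih (ltnW MN).
    by rewrite /in_window; case: (boolP (_ && _)) => /=; lia.
  by apply: (leq_trans (h N _)) => //; exact: geq_minr.
have h M : (M <= N)%N -> (\sum_(t < M) (~~ in_window N (t%:Z - Negz c)) <= (M + c.+1) - N)%N.
  elim: M => [|M ih] MN; first by rewrite big_ord0.
  rewrite big_ord_recr /=; have := ih (ltnW MN).
  by rewrite /in_window; case: (boolP (_ && _)) => /=; lia.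
by apply: (leq_trans (h N _)) => //; lia.
Qed.

Lemma window_length_exists (d : R) : 0 < d -> d < 1 ->
  exists2 N : nat, (0 < N)%N & N%:R^-1 <= Num.sqrt d /\ d * N%:R <= 2 * Num.sqrt d.
Proof.
move=> d0 d1; set r := Num.sqrt d.
have r0 : 0 < r by rewrite sqrtr_gt0.
have rr : d = r * r by rewrite -expr2 sqr_sqrtr // ltW.
have r1 : r < 1 by nra.
exists (Num.truncn r^-1).+1 => //.
have ri : 0 <= r^-1 by rewrite invr_ge0 ltW.
have /andP[h1 h2] := truncn_itv ri.
set N : R := (_.+1)%:R in h2 *.
have N0 : 0 < N by rewrite ltr0n.
have NE : N <= r^-1 + 1 by rewrite /N -natr1 lerD2r.
split; first by rewrite -[leRHS]invrK lef_pV2 ?posrE ?invr_gt0 // ltW.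
rewrite [in leLHS]rr -mulrA [leRHS]mulrC ler_pM2l //.
have : r * N <= r * (r^-1 + 1) by rewrite ler_pM2l.
by rewrite mulrDr mulfV ?gt_eqF // mulr1; lra.
Qed.

(** The new cocycle phase [e(d k_p l_q)] is not a
    bounded multiplier by itself, but damped by a factor [m (i - j)] it is the Gram
    matrix of the unit vectors
    [x |-> L^(-1/2) e(d x i_p) 1_(0 <= x - i_q < L)] of [l^2 Z], which come from the
    box function moved by a shift and a modulation. So the kernel of [m * a] keeps
    the bound [K]. The damping costs [|k_q| / L] because translated windows overlap
    only partly, and [2 pi |d| L |k_p|] because the modulation varies over a window;
    the choice [L ~ |d| ^ (-1/2)] balances the two and gives the exponent [1/2]. *)
Lemma l2_bounded_twist_step phi (p q : 'I_n) (d K N : R) a : 0 <= K ->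
  (forall F, uniq F -> \sum_(k <- F) normc (a k) * weight R k <= N) ->
  l2_bounded (twisted_kernel phi a) K ->
  l2_bounded (twisted_kernel (fun k l => phi k l + d * (k 0 p)%:~R * (l 0 q)%:~R) a)
    (K + (1 + 4 * trigo.pi) * Num.sqrt `|d| * N).
Proof.
move=> K0 ha hK; set phi' := fun k l => _.
set C := 1 + 4 * trigo.pi.
have p0 := pi_ge0 R.
have C1 : 1 <= C by rewrite /C lerDl mulr_ge0.
have N0 : 0 <= N by have := ha [::] isT; rewrite big_nil.
have w1 (k : 'rV[int]_n) : 1 <= weight R k.
  by rewrite /weight lerDl; apply: sumr_ge0 => i _; rewrite ler0z.
have wi (k : 'rV[int]_n) i : (`|k 0 i|)%:~R <= weight R k.
  rewrite /weight (bigD1 i) //= [X in _ <= _ + X]addrC addrA lerDr addr_ge0 //.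
  by apply: sumr_ge0 => j _; rewrite ler0z.
have ha1 F : uniq F -> \sum_(k <- F) normc (a k) <= N.
  move=> uF; apply: le_trans (ha F uF); apply: ler_sum => k _.
  by rewrite ler_peMr ?normc_ge0.
have [dz|dn] := eqVneq d 0.
  apply: (@l2_bounded_le _ _ _ K) => //; first by rewrite lerDl !mulr_ge0 ?sqrtr_ge0 //; lra.
  apply: eq_l2_bounded hK => i j; rewrite /twisted_kernel; congr (e _ * _).
  by rewrite /phi' dz !mul0r addr0.
have d0 : 0 < `|d| by rewrite normr_gt0.
(* For [|d| >= 1] the trivial [l^1] bound suffices. *)
have [d1|d1] := leP 1 `|d|.
  apply: (@l2_bounded_le _ _ _ N) => //; last exact: l2_bounded_kernel_l1.
  have s1 : 1 <= Num.sqrt `|d| by rewrite -sqrtr1 ler_sqrt.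
  have : 1 * N <= C * Num.sqrt `|d| * N by rewrite ler_wpM2r //; nra.
  by lra.
have [L L0 [L1 L2]] := window_length_exists d0 d1.
have LR : 0 < L%:R :> R by rewrite ltr0n.
pose m (k : 'rV[int]_n) : R[i] :=
  (L%:R^-1)%:C * \sum_(t < L | in_window L (t%:Z - k 0 q)) e (d * t%:R * (k 0 p)%:~R).
have m_close k : normc (1 - m k) <= C * Num.sqrt `|d| * weight R k.
  have -> : 1 - m k = (L%:R^-1)%:C * \sum_(t < L)
      (1 - (if in_window L (t%:Z - k 0 q) then e (d * t%:R * (k 0 p)%:~R) else 0)).
    rewrite sumrB mulrBr -big_mkcond /=; congr (_ - _).
    rewrite big_const_ord iter_addr_0 -(rmorph_nat (real_complex R)) -rmorphM /=.
    by rewrite mulVf ?gt_eqF.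
  rewrite normcM normc_real ger0_norm ?invr_ge0 ?ler0n //.
  have h : normc (\sum_(t < L)
      (1 - (if in_window L (t%:Z - k 0 q) then e (d * t%:R * (k 0 p)%:~R) else 0))) <=
      (`|k 0 q|)%:~R + L%:R * (2 * trigo.pi * (`|d| * L%:R * (`|k 0 p|)%:~R)).
    apply: (le_trans (normc_sum _ _ _)).
    apply: (@le_trans _ _ (\sum_(t < L) ((~~ in_window L (t%:Z - k 0 q) : nat)%:R +
        2 * trigo.pi * (`|d| * L%:R * (`|k 0 p|)%:~R)))).
      apply: ler_sum => t _; have z0 : 0 <= 2 * trigo.pi * (`|d| * L%:R * (`|k 0 p|)%:~R).
        by rewrite !mulr_ge0 // ler0z.
      case: ifP => _; last by rewrite [X in _ <= X + _](_ : _ = 1) // subr0 normc1 lerDl.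
      rewrite [X in _ <= X + _](_ : _ = 0) // add0r (le_trans (normc_sub_expi2pi _)) // ler_wpM2l ?mulr_ge0 //.
      rewrite !normrM intr_norm ler_wpM2r // ler_wpM2l // ger0_norm ?ler0n //.
      by rewrite ler_nat ltnW.
    rewrite big_split /= lerD ?window_exit_count //.
    by rewrite big_const_ord iter_addr_0 [leRHS]mulr_natl lexx.
  apply: (@le_trans _ _ (L%:R^-1 * (weight R k + L%:R * (2 * trigo.pi * (`|d| * L%:R * weight R k))))).
    rewrite ler_wpM2l ?invr_ge0 ?ler0n // (le_trans h) // lerD ?wi //.
    by rewrite ler_wpM2l ?ler0n // ler_wpM2l ?mulr_ge0 // ler_wpM2l ?mulr_ge0 ?ler0n.
  rewrite mulrDr mulKf ?gt_eqF //.
  have -> : C * Num.sqrt `|d| * weight R k = Num.sqrt `|d| * weight R k +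
     2 * trigo.pi * ((2 * Num.sqrt `|d|) * weight R k) by rewrite /C; ring.
  have w0 : 0 <= weight R k by apply: le_trans (w1 k).
  apply: lerD; first by rewrite ler_wpM2r.
  by rewrite ler_wpM2l ?mulr_ge0 // ler_wpM2r.
have hfar : l2_bounded (twisted_kernel phi' (fun k => (1 - m k) * a k)) (C * Num.sqrt `|d| * N).
  apply: l2_bounded_kernel_l1 => F uF.
  apply: (@le_trans _ _ (C * Num.sqrt `|d| * \sum_(k <- F) normc (a k) * weight R k)).
    rewrite mulr_sumr; apply: ler_sum => k _.
    by rewrite normcM [normc (a k) * _]mulrC mulrA ler_wpM2r ?normc_ge0.
  by rewrite ler_wpM2l ?ha // mulr_ge0 ?sqrtr_ge0 //; lra.
suff hclose : l2_bounded (twisted_kernel phi' (fun k => m k * a k)) K.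
  have := l2_boundedD K0 _ hclose hfar; move=> /(_ _) h.
  apply: eq_l2_bounded (h _) => [i j|].
    by rewrite /twisted_kernel -mulrDr -mulrDl [m _ + _]addrC subrK mul1r.
  by rewrite !mulr_ge0 ?sqrtr_ge0 //; lra.
move=> s t y us ut.
pose X := undup [seq (k : 'rV[int]_n) 0 q + z%:Z | k <- s ++ t, z <- iota 0 L].
have hX k : k \in s ++ t -> forall z, (z < L)%N -> k 0 q + z%:Z \in X.
  move=> kst z zL; rewrite mem_undup; apply/allpairsP; exists (k, z) => /=; split=> //.
  by rewrite mem_iota.
(* The sign [sg] distinguishes a feature vector from its complex conjugate. *)
pose c : R[i] := ((Num.sqrt L%:R)^-1)%:C.
have cc : c * c = (L%:R^-1)%:C.
  by rewrite -rmorphM /= -invfM -expr2 sqr_sqrtr // ltW.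
pose w (sg : R) (x : int) (k : 'rV[int]_n) : R[i] :=
  if in_window L (x - k 0 q) then c * e (sg * (d * x%:~R * (k 0 p)%:~R)) else 0.
have hw sg k : k \in s ++ t -> \sum_(x <- X) normc (w sg x k) ^+ 2 <= 1.
  move=> kst.
  have -> : \sum_(x <- X) normc (w sg x k) ^+ 2 =
      \sum_(x <- X | in_window L (x - k 0 q)) (L%:R^-1 : R).
    rewrite [RHS]big_mkcond /=; apply: eq_bigr => x _; rewrite /w; case: ifP => _.
      by rewrite normcM normc_expi2pi mulr1 expr2 -normcM cc normc_real ger0_norm ?invr_ge0 ?ler0n.
    by rewrite normc0 expr0n.
  rewrite window_sum ?undup_uniq //; last exact: hX.
  by rewrite big_const_ord iter_addr_0 -[_ *+ L]mulr_natr mulVf ?gt_eqF.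
have hwt i : i \in t -> \sum_(x <- X) normc (w 1 x i) ^+ 2 <= 1.
  by move=> it; apply: hw; rewrite mem_cat it orbT.
have hws j : j \in s -> \sum_(x <- X) normc (w (-1) x j) ^+ 2 <= 1.
  by move=> js; apply: hw; rewrite mem_cat js.
apply: le_trans (schur_multiplier y hK us ut hwt hws).
rewrite le_eqVlt; apply/orP; left; apply/eqP.
rewrite big_seq [RHS]big_seq; apply: eq_bigr => i it; congr (normc _ ^+ 2).
rewrite big_seq [RHS]big_seq; apply: eq_bigr => j js; congr (_ * _).
have -> : \sum_(x <- X) w 1 x i * w (-1) x j = e (d * (j 0 q)%:~R * ((i - j) 0 p)%:~R) * m (i - j).
  have -> : \sum_(x <- X) w 1 x i * w (-1) x j =
      \sum_(x <- X | in_window L (x - j 0 q)) (L%:R^-1)%:C *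
        (if in_window L (x - i 0 q) then e (d * x%:~R * ((i - j) 0 p)%:~R) else 0).
    rewrite [RHS]big_mkcond /=; apply: eq_bigr => x _; rewrite /w.
    case: ifP => _; case: ifP => _; rewrite ?mulr0 ?mul0r //.
    rewrite mulrACA cc -expi2piD; congr (_ * e _).
    by rewrite mxE mxE intrD mulrNz; ring.
  rewrite window_sum ?undup_uniq //; last by apply: hX; rewrite mem_cat js.
  rewrite /m mulrCA !mulr_sumr [RHS]big_mkcond; apply: eq_bigr => z _.
  have -> : j 0 q + z%:Z - i 0 q = z%:Z - (i - j) 0 q by rewrite !mxE; ring.
  case: ifP => _; rewrite ?mulr0 //; congr (_ * _).
  by rewrite -expi2piD; congr e; rewrite intrD mulrDr mulrDl.
rewrite /twisted_kernel /phi' expi2piD.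
rewrite [d * _ * (j 0 q)%:~R]mulrAC.
by ring.
Qed.

End Kernel.

(** * Comparison of two tori *)
Lemma sum_uniq_sub (I : eqType) (V : nmodType) (F0 F : seq I) (f : I -> V) :
  uniq F0 -> uniq F -> {subset F0 <= F} ->
  \sum_(k <- F) f k = \sum_(k <- F0) f k + \sum_(k <- F | k \notin F0) f k.
Proof.
move=> u0 u sub; rewrite (bigID (mem F0)) /=; congr (_ + _).
rewrite -big_filter; apply: perm_big; apply: uniq_perm; rewrite ?filter_uniq // => k.
by rewrite mem_filter; apply/andP/idP => [[]|kF] //; split=> //; exact: sub.
Qed.

Section FiniteSums.
Variables (R : realType) (n : nat) (Theta : 'M[R]_n) (A : cstarAlgType R) (U : 'I_n -> A).
Hypothesis hT : is_nctorus Theta U.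
Local Notation W := (monomial U).
Local Notation e := (@expi2pi R).
Local Notation phi := (twist Theta (all_pairs n)).
Variables (F : seq 'rV[int]_n) (a : 'rV[int]_n -> R[i]).
Hypothesis uF : uniq F.

Definition zero_outside k : R[i] := if k \in F then a k else 0.
Local Notation M := (twisted_kernel phi zero_outside).
Local Notation X := (\sum_(k <- F) a k *: W k).

Lemma mul_sum_monomial (s T : seq 'rV[int]_n) (y : 'rV[int]_n -> R[i]) :
  uniq T -> (forall k j, k \in F -> j \in s -> k + j \in T) ->
  X * (\sum_(j <- s) y j *: W j) =
  \sum_(i <- T) (\sum_(j <- s) M i j * y j) *: W i.
Proof.
move=> uT hT'; rewrite mulr_sumr.
under [RHS]eq_bigr => i _ do rewrite scaler_suml.
rewrite [RHS]exchange_big /= big_seq [RHS]big_seq; apply: eq_bigr => j js.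
rewrite mulr_suml (sum_uniq_sub (F0 := [seq k + j | k <- F]) (F := T)) //; last first.
- by move=> _ /mapP[k kF ->]; exact: hT'.
- by rewrite map_inj_uniq // => k l /addIr.
rewrite [X in _ = _ + X]big1 ?addr0; last first.
  move=> i iF; rewrite /twisted_kernel /zero_outside ifN ?mulr0 ?mul0r ?scale0r //.
  by apply: contra iF => h; apply/mapP; exists (i - j); rewrite ?subrK.
rewrite big_map big_seq [RHS]big_seq; apply: eq_bigr => k kF.
rewrite scale_mull scale_mulr (monomialM hT) !scale_scale /twisted_kernel addrK /zero_outside kF.
by congr (_ *: _); ring.
Qed.

Lemma trig_poly_finite (s : seq 'rV[int]_n) (y : 'rV[int]_n -> R[i]) :
  trig_poly U (\sum_(j <- s) y j *: W j).
Proof. by apply: trig_poly_sum => j; apply: trig_polyZ; exact: trig_poly_monomial. Qed.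

Definition product_support (s t : seq 'rV[int]_n) := undup (t ++ [seq k + j | k <- F, j <- s]).

Lemma sqnorm2_mul (s t : seq 'rV[int]_n) y : uniq s ->
  sqnorm2 U (X * (\sum_(j <- s) y j *: W j)) =
  \sum_(i <- product_support s t) normc (\sum_(j <- s) M i j * y j) ^+ 2.
Proof.
move=> us; rewrite (mul_sum_monomial (T := product_support s t)) ?undup_uniq //.
  by rewrite (sqnorm2E hT) ?undup_uniq.
move=> k j kF js; rewrite mem_undup mem_cat; apply/orP; right.
by apply/allpairsP; exists (k, j).
Qed.

(** Together with the next lemma: the C*-norm of a finite sum is exactly the
    operator norm of its twisted convolution kernel on [l^2 Z^n]. *)
Lemma l2_bounded_cnorm : l2_bounded M (cnorm X).
Proof.
move=> s t y us ut; rewrite -[in leRHS](sqnorm2E hT) //.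
apply: le_trans (sqnorm2M hT (trig_poly_finite F a) (trig_poly_finite s y)).
rewrite (sqnorm2_mul t) // (sum_uniq_sub (F0 := t) (F := product_support s t)) ?undup_uniq //.
  by rewrite lerDl; apply: sumr_ge0 => i _; exact: sqr_ge0.
by move=> k kt; rewrite mem_undup mem_cat kt.
Qed.

Lemma cnorm_le_l2_bounded K : 0 <= K -> l2_bounded M K -> cnorm X <= K.
Proof.
move=> K0 hK; apply: (cnorm_le_opnorm2 hT) => //; first exact: trig_poly_finite.
move=> Y [r [y ->]]; rewrite (sqnorm2_mul [::]) ?uniq_box // (sqnorm2E hT) ?uniq_box //.
by apply: hK; rewrite ?undup_uniq ?uniq_box.
Qed.

End FiniteSums.

Section Compare.
Variables (R : realType) (n : nat).

(** The change of cocycle is spread over the pairs in [ps], one entry of [D] per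
    step; the losses add up. *)
Lemma l2_bounded_twist (D : 'M[R]_n) (ps : seq ('I_n * 'I_n)) phi (a : 'rV[int]_n -> R[i]) (K N : R) :
  0 <= K -> (forall F, uniq F -> \sum_(k <- F) normc (a k) * weight R k <= N) ->
  l2_bounded (twisted_kernel phi a) K ->
  l2_bounded (twisted_kernel (fun k l => phi k l + twist D ps k l) a)
    (K + (1 + 4 * trigo.pi) * (\sum_(pq <- ps) Num.sqrt `|D pq.1 pq.2|) * N).
Proof.
move=> K0 ha; have N0 : 0 <= N by have := ha [::] isT; rewrite big_nil.
have p0 := pi_ge0 R.
elim: ps phi K K0 => [|[p q] ps ih] phi K K0 h.
  rewrite big_nil mulr0 mul0r addr0; apply: eq_l2_bounded h => i j.
  by rewrite /twisted_kernel /twist big_nil addr0.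
rewrite big_cons mulrDr mulrDl addrA.
have := ih _ _ _ (l2_bounded_twist_step p q (D p q) K0 ha h).
move=> /(_ _) h'; apply: eq_l2_bounded (h' _) => [i j|].
  by rewrite /twisted_kernel /twist big_cons addrA.
by rewrite addr_ge0 // !mulr_ge0 ?sqrtr_ge0 // addr_ge0 // mulr_ge0.
Qed.

Lemma cnorm_finite_le (Theta Theta' : 'M[R]_n) (A A' : cstarAlgType R)
    (U : 'I_n -> A) (U' : 'I_n -> A') (F : seq 'rV[int]_n) (a : 'rV[int]_n -> R[i]) (N d : R) :
  is_nctorus Theta U -> is_nctorus Theta' U' -> uniq F ->
  (forall F, uniq F -> \sum_(k <- F) normc (a k) * weight R k <= N) ->
  (forall p q, `|(Theta - Theta') p q| <= d) ->
  cnorm (\sum_(k <- F) a k *: monomial U k) <=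
  cnorm (\sum_(k <- F) a k *: monomial U' k) +
  (1 + 4 * trigo.pi) * (size (all_pairs n))%:R * N * Num.sqrt d.
Proof.
move=> hT hT' uF ha hd.
have N0 : 0 <= N by have := ha [::] isT; rewrite big_nil.
have p0 := pi_ge0 R.
have w0 k : 0 <= weight R (n := n) k.
  by rewrite /weight addr_ge0 //; apply: sumr_ge0 => i _; rewrite ler0z.
have ha' F' : uniq F' -> \sum_(k <- F') normc (zero_outside F a k) * weight R k <= N.
  move=> uF'; apply: le_trans (ha F' uF'); apply: ler_sum => k _.
  by rewrite /zero_outside; case: ifP => _ //; rewrite normc0 mul0r mulr_ge0 ?normc_ge0.
have h := l2_bounded_twist (Theta - Theta') (all_pairs n) (cnorm_ge0 _) ha' (l2_bounded_cnorm hT' a uF).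
set E := _ * _ * N in h.
have E0 : 0 <= E.
  rewrite /E !mulr_ge0 //; first by rewrite addr_ge0 // mulr_ge0.
  by apply: sumr_ge0 => pq _; exact: sqrtr_ge0.
have {}h : cnorm (\sum_(k <- F) a k *: monomial U k) <=
  cnorm (\sum_(k <- F) a k *: monomial U' k) + E.
  apply: (cnorm_le_l2_bounded hT uF); first by rewrite addr_ge0 ?cnorm_ge0.
  apply: eq_l2_bounded h => i j; rewrite /twisted_kernel; congr (expi2pi _ * _).
  rewrite /twist -big_split /=; apply: eq_bigr => pq _.
  by rewrite !mxE; ring.
apply: (le_trans h); rewrite lerD2l /E.
have -> : (1 + 4 * trigo.pi) * (size (all_pairs n))%:R * N * Num.sqrt d =
  (1 + 4 * trigo.pi) * ((size (all_pairs n))%:R * Num.sqrt d) * N by ring.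
rewrite ler_wpM2r // ler_wpM2l ?addr_ge0 ?mulr_ge0 //.
apply: (@le_trans _ _ (\sum_(pq <- all_pairs n) Num.sqrt d)).
  by apply: ler_sum => pq _; rewrite ler_wsqrtr.
by rewrite big_const_seq count_predT iter_addr_0 mulr_natl.
Qed.

Lemma entry_le_opnorm (M : 'M[R]_n) p q : `|M p q| <= opnorm M.
Proof.
have sq_le (x : 'cV[R]_n) i : `|x i 0| <= euclid_norm x.
  rewrite /euclid_norm -sqrtr_sqr ler_wsqrtr // (bigD1 i) //= lerDl.
  by apply: sumr_ge0 => j _; exact: sqr_ge0.
have dn : euclid_norm (delta_mx q 0 : 'cV[R]_n) = 1.
  rewrite /euclid_norm (bigD1 q) //= big1 ?addr0.
    by rewrite mxE !eqxx expr1n sqrtr1.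
  by move=> j /negPf jq; rewrite mxE jq expr0n.
apply: (@le_trans _ _ (euclid_norm (M *m delta_mx q 0))).
  by have := sq_le (M *m delta_mx q 0) p; rewrite -colE mxE.
apply: ub_le_sup; last by exists (delta_mx q 0) => //=; rewrite dn.
exists (Num.sqrt (\sum_i (\sum_j `|M i j|) ^+ 2)) => _ [x /= x1 <-].
rewrite /euclid_norm ler_wsqrtr //; apply: ler_sum => i _.
rewrite -real_normK ?num_real // lerXn2r ?nnegrE ?sumr_ge0 // mxE.
apply: (le_trans (ler_norm_sum _ _ _)); apply: ler_sum => j _.
by rewrite normrM ler_piMr // (le_trans (sq_le x j)).
Qed.

Variable a : 'rV[int]_n -> R[i].
Hypothesis ha : in_l1weight a.
Let N := fine (l1weight_norm a).

Lemma weight_ge1 (k : 'rV[int]_n) : 1 <= weight R k.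
Proof. by rewrite /weight lerDl; apply: sumr_ge0 => i _; rewrite ler0z. Qed.

Lemma l1weight_normE : l1weight_norm a = N%:E.
Proof.
rewrite fineK // ge0_fin_numE //; apply: esum_ge0 => k _.
by rewrite lee_fin mulr_ge0 ?normc_ge0 // (le_trans _ (weight_ge1 k)).
Qed.

Lemma finite_sum_le_l1weight (F : seq 'rV[int]_n) :
  uniq F -> \sum_(k <- F) normc (a k) * weight R k <= N.
Proof.
move=> uF; rewrite -lee_fin -l1weight_normE; apply: esum_ge.
exists [set` F]; first by split => //; exact: finite_seq.
by rewrite -fsbig_seq // sumEFin.
Qed.

Lemma l1weight_norm_approx (d : R) : 0 < d -> exists2 F : seq 'rV[int]_n, uniq F &
  N - d < \sum_(k <- F) normc (a k) * weight R k.
Proof.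
move=> d0; have hfin : l1weight_norm a \is a fin_num by rewrite l1weight_normE.
have [_ [S [finS _] <-]] := ub_ereal_sup_adherent d0 hfin.
rewrite -[ereal_sup _]/(l1weight_norm a) l1weight_normE fsbig_finite //= sumEFin -EFinB lte_fin => h.
by exists (fset_set S); [exact: fset_uniq|].
Qed.

(** Absolute convergence of the coefficients makes the net of finite partial sums
    Cauchy, so [pi_rep] is a genuine limit and not a default value. *)
Lemma pi_rep_approx (A : cstarAlgType R) (U : 'I_n -> A) (Theta : 'M[R]_n) :
  is_nctorus Theta U -> forall d, 0 < d ->
  summability.totally [set J : {fset 'rV[int]_n} |
    cnorm (pi_rep U a - \sum_(k <- J) a k *: monomial U k) < d].
Proof.
move=> hT d d0.
pose u := summability.partial_sum (fun k => a k *: monomial U k).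
have uE (J : {fset 'rV[int]_n}) : u J = \sum_(k <- J) a k *: monomial U k.
  by rewrite /u /summability.partial_sum big_seq_fsetE.
have tail F0 (J : {fset 'rV[int]_n}) : uniq F0 -> {subset F0 <= J} ->
    cnorm (u J - \sum_(k <- F0) a k *: monomial U k) <=
    N - \sum_(k <- F0) normc (a k) * weight R k.
  move=> u0 sub; have uJ : uniq J by exact: fset_uniq.
  rewrite uE (sum_uniq_sub _ u0 uJ sub) addrAC subrr add0r lerBrDl.
  apply: le_trans (finite_sum_le_l1weight uJ).
  rewrite (sum_uniq_sub _ u0 uJ sub) lerD2l (le_trans (cnorm_sum _ _ _)) //.
  apply: ler_sum => k _; rewrite cnormZ (cnorm_monomial hT).
  by rewrite ler_wpM2l ?normc_ge0 ?weight_ge1.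
have Cu c : 0 < c -> exists2 S : set {fset 'rV[int]_n}, @summability.totally _ S &
     forall s t, S s -> S t -> cnorm (u s - u t) < c.
  move=> c0; have c2 : 0 < c / 2 by rewrite divr_gt0.
  have [F0 uF0 hF0] := l1weight_norm_approx c2.
  exists [set J : {fset 'rV[int]_n} | {subset F0 <= J}].
    exists [fset k in F0]%fset => // J /= /fsubsetP sub k kF0.
    by apply: sub; rewrite inE.
  move=> s t /= sF tF; set z := \sum_(k <- F0) a k *: monomial U k.
  have -> : u s - u t = (u s - z) - (u t - z) by rewrite opprB addrA subrK.
  apply: (le_lt_trans (cnormD _ _)); rewrite cnormN.
  have := tail _ _ uF0 sF; have := tail _ _ uF0 tF; rewrite -/z.
  by move: hF0; set w := \sum_(k <- F0) _; lra.
have PF := @summability.totally_filter ('rV[int]_n : choiceType).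
have H : summability.totally [set J | cnorm (pi_rep U a - u J) < d].
  exact: (cauchy_limit PF Cu d0).
by apply: (filterS _ H) => J /=; rewrite uE.
Qed.

End Compare.

Theorem theorem3p1 (R : realType) (n : nat) (n_ge1 : (1 <= n)%N) :
  exists2 C : R, 0 < C &
    forall a : 'rV[int]_n -> R[i], in_l1weight a ->
    forall Theta Theta' : 'M[R]_n, skew_mx Theta -> skew_mx Theta' ->
    forall (A : cstarAlgType R) (U : 'I_n -> A), is_nctorus Theta U ->
    forall (A' : cstarAlgType R) (U' : 'I_n -> A'), is_nctorus Theta' U' ->
      `| cnorm (pi_rep U a) - cnorm (pi_rep U' a) |
      <= C * fine (l1weight_norm a) * Num.sqrt (opnorm (Theta - Theta')).
Proof.
pose C : R := (1 + 4 * trigo.pi) * (size (all_pairs n))%:R.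
have C0 : 0 <= C by rewrite mulr_ge0 // addr_ge0 // mulr_ge0 // pi_ge0.
exists (C + 1); first by rewrite ltr_wpDl.
move=> a ha Theta Theta' _ _ A U hT A' U' hT'.
set N := fine _; set d := opnorm _.
have N0 : 0 <= N.
  by have := finite_sum_le_l1weight ha (isT : uniq [::]); rewrite big_nil.
apply: (@le_trans _ _ (C * N * Num.sqrt d)); last first.
  by rewrite ler_wpM2r ?sqrtr_ge0 // ler_wpM2r // lerDl.
(* Both norms are approximated along one common finite set of frequencies. *)
apply/ler_addgt0Pr => e e0.
have e2 : 0 < e / 2 by rewrite divr_gt0.
have PF := @summability.totally_filter ('rV[int]_n : choiceType).
have [J [hJ hJ']] := filter_ex (filterI (pi_rep_approx ha hT e2) (pi_rep_approx ha hT' e2)).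
have hd p q : `|(Theta - Theta') p q| <= d by exact: entry_le_opnorm.
have hd' p q : `|(Theta' - Theta) p q| <= d.
  by have := hd p q; rewrite !mxE distrC.
have uJ := fset_uniq J.
have := cnorm_finite_le hT hT' uJ (finite_sum_le_l1weight ha) hd.
have := cnorm_finite_le hT' hT uJ (finite_sum_le_l1weight ha) hd'.
rewrite -/C -/N.
have tri (B : cstarAlgType R) (x y : B) : cnorm (x - y) < e / 2 -> cnorm x < cnorm y + e / 2 /\ cnorm y < cnorm x + e / 2.
  move=> h; have := cnormD (x - y) y; rewrite subrK.
  by have := cnormD (y - x) x; rewrite subrK cnormB; split; lra.
have [] := tri _ _ _ hJ; have [] := tri _ _ _ hJ'.
move: (cnorm (\sum_(k <- J) _)) (cnorm (\sum_(k <- J) _)) => x x'.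
by rewrite ler_norml => *; apply/andP; split; lra.
Qed.
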